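(* For every $k\in\mathbb{N}$, the operator $S\oplus(S_k^+)^*$ is cyclic, where $S$ is the simple bilateral shift on $\ell^2(\mathbb{Z})$ and $S_k^+$ is the orthogonal sum of $k$ copies of the simple unilateral shift $S^+$ on $\ell^2(\mathbb{N}_0)$.
   Context: $Se_n=e_{n+1}$ ($n\in\mathbb{Z}$) and $S^+e_n=e_{n+1}$ ($n\in\mathbb{N}_0$) for the standard orthonormal bases. An operator $T$ on $\mathcal{H}$ is cyclic if there is $h$ with $\bigvee\{T^nh:n\in\mathbb{N}_0\}=\mathcal{H}$. *)

(* Defs.v *)
From Stdlib Require Import Reals ZArith List.
Import ListNotations.
Open Scope R_scope.

Definition C := (R * R)%type.
Definition C0 : C := (0, 0).
Definition Cadd (a b : C) : C := (fst a + fst b, snd a + snd b).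
Definition Copp (a : C) : C := (- fst a, - snd a).
Definition Cmul (a b : C) : C :=
  (fst a * fst b - snd a * snd b, fst a * snd b + snd a * fst b).
Definition Cnorm2 (a : C) : R := fst a * fst a + snd a * snd a.

(* The Hilbert space H_k = l^2(Z) (+) (l^2(N_0))^k.
   A vector is a pair (u, v): u : Z -> C the l^2(Z) component,
   v j n (j < k, n : nat) the n-th coordinate of the j-th copy of l^2(N_0). *)
Definition vec := ((Z -> C) * (nat -> nat -> C))%type.

Definition vadd (x y : vec) : vec :=
  (fun z => Cadd (fst x z) (fst y z), fun j n => Cadd (snd x j n) (snd y j n)).
Definition vsub (x y : vec) : vec :=
  (fun z => Cadd (fst x z) (Copp (fst y z)),
   fun j n => Cadd (snd x j n) (Copp (snd y j n))).
Definition vscale (c : C) (x : vec) : vec :=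
  (fun z => Cmul c (fst x z), fun j n => Cmul c (snd x j n)).
Definition vzero : vec := (fun _ => C0, fun _ _ => C0).

Fixpoint sumZ (f : Z -> R) (l : list Z) : R :=
  match l with [] => 0 | z :: l' => f z + sumZ f l' end.
Fixpoint sumNN (f : nat -> nat -> R) (l : list (nat * nat)) : R :=
  match l with [] => 0 | p :: l' => f (fst p) (snd p) + sumNN f l' end.

Definition energy (k : nat) (x : vec) (l : list Z) (m : list (nat * nat)) : R :=
  sumZ (fun z => Cnorm2 (fst x z)) l
  + sumNN (fun j n => if Nat.ltb j k then Cnorm2 (snd x j n) else 0) m.

Definition inH (k : nat) (x : vec) : Prop :=
  (forall j n, (k <= j)%nat -> snd x j n = C0) /\
  exists B : R, forall l m, NoDup l -> NoDup m -> energy k x l m <= B.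

Definition dist_lt (k : nat) (x y : vec) (eps : R) : Prop :=
  exists d : R, 0 <= d /\ d < eps /\
    forall l m, NoDup l -> NoDup m -> energy k (vsub x y) l m <= d * d.

(* T = S (+) (S_k^+)^* : S e_n = e_{n+1} on l^2(Z), so (S u)(z) = u(z-1);
   (S^+)^* e_n = e_{n-1}, (S^+)^* e_0 = 0, so ((S^+)^* w)(n) = w(n+1). *)
Definition Top (x : vec) : vec :=
  (fun z => fst x (z - 1)%Z, fun j n => snd x j (S n)).

Definition Tpow (n : nat) (x : vec) : vec := Nat.iter n Top x.

Fixpoint lincomb (c : nat -> C) (h : vec) (N : nat) : vec :=
  match N with
  | O => vscale (c O) h
  | S N' => vadd (lincomb c h N') (vscale (c N) (Tpow N h))
  end.

Definition cyclic_T (k : nat) : Prop :=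
  exists h : vec, inH k h /\
    forall x : vec, inH k x -> forall eps : R, 0 < eps ->
      exists (N : nat) (c : nat -> C), dist_lt k x (lincomb c h N) eps.

(* Main.v *)
(** Realise the bilateral shift as multiplication by [z] on the circle and put
    [s = (1 - cos t) / 2], [f = exp (-1/s)].  The polynomial [P_n] whose real part is
    [n] times the Fejer kernel satisfies [Re P_n <= 1/s] and [P_n(0) = n], so
    [G = (1 + (P_n - n)/N)^N], which imitates [exp (P_n - n)], has [G(0) = 1] while
    [|G f|] is about [exp (-n)]: the Fourier vector [u] of [f] is nearly annihilated
    by polynomials with constant term 1.

    This has two consequences.  Writing [G = 1 + z G'], the closed span of the
    forward orbit of [u] is invariant under the inverse shift; as [1/f] is
    approximated by polynomials in [s], it is everything.  And if [v] carries rapidly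
    decreasing amplitudes [a_m] at positions [m^2], distributed cyclically over the
    [k] copies of [l^2(N)], then applying [G_m(T) T^(m^2 - n) / a_m] to [(u, v)], with
    [|G_m u|] much smaller than [a_m], gives approximately [G_m(B) e_(j,n)], that is
    [e_(j,n)] plus a combination of lower basis vectors of the same copy.  By
    induction on [n] the closed span of the orbit of [(u, v)] contains every
    [(0, e_(j,n))], hence [(u, 0)], hence the whole space. *)

From Stdlib Require Import Reals ZArith List FinFun Lra Lia Psatz.
From Stdlib Require Import FunctionalExtensionality ClassicalEpsilon.
From Coquelicot Require Import Coquelicot.
Require Import Defs.
Import ListNotations.
Open Scope R_scope.

(** * Squared norms and the closed span of an orbit *)

Lemma vec_ext (x y : vec) :
  (forall z, fst x z = fst y z) -> (forall j n, snd x j n = snd y j n) -> x = y.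
Proof.
  destruct x as [x1 x2], y as [y1 y2]; simpl; intros H1 H2.
  f_equal; [|apply functional_extensionality; intros j];
    apply functional_extensionality; auto.
Qed.

Ltac ceq :=
  unfold Cadd, Cmul, Copp, C0; simpl; apply injective_projections; simpl;
  try ring.

Ltac veq := apply vec_ext; intros; simpl; ceq.

(** Bounding all finite partial sums stands in for the squared norm, so no infinite series has to be
    summed. *)
Definition norm2_le (k : nat) (x : vec) (B : R) : Prop :=
  forall l m, NoDup l -> NoDup m -> energy k x l m <= B.

Lemma Cnorm2_ge0 a : 0 <= Cnorm2 a.
Proof. apply Rplus_le_le_0_compat; apply Rle_0_sqr. Qed.

Lemma Cnorm2_add a b : Cnorm2 (Cadd a b) <= 2 * Cnorm2 a + 2 * Cnorm2 b.
Proof.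
  destruct a as [a1 a2], b as [b1 b2]; unfold Cnorm2, Cadd; simpl.
  generalize (Rle_0_sqr (a1 - b1)) (Rle_0_sqr (a2 - b2)); unfold Rsqr; lra.
Qed.

Lemma Cnorm2_mul a b : Cnorm2 (Cmul a b) = Cnorm2 a * Cnorm2 b.
Proof. destruct a, b; unfold Cnorm2, Cmul; simpl; ring. Qed.

Lemma sumNN_ge0 f l : (forall j n, 0 <= f j n) -> 0 <= sumNN f l.
Proof.
  intros H; induction l as [|p l IH]; simpl; [lra|].
  specialize (H (fst p) (snd p)); lra.
Qed.

Lemma sumNN_le f g l :
  (forall j n, f j n <= g j n) -> sumNN f l <= sumNN g l.
Proof.
  intros H; induction l as [|p l IH]; simpl; [lra|].
  specialize (H (fst p) (snd p)); lra.
Qed.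

Lemma sumNN_scal c f l : sumNN (fun j n => c * f j n) l = c * sumNN f l.
Proof. induction l as [|p l IH]; simpl; [|rewrite IH]; ring. Qed.

Lemma sumZ_app f l l' : sumZ f (l ++ l') = sumZ f l + sumZ f l'.
Proof. induction l as [|z l IH]; simpl; [|rewrite IH]; ring. Qed.

Lemma sumNN_app f l l' : sumNN f (l ++ l') = sumNN f l + sumNN f l'.
Proof. induction l as [|z l IH]; simpl; [|rewrite IH]; ring. Qed.

Lemma sumNN_incl f l l' :
  (forall j n, 0 <= f j n) -> NoDup l -> incl l l' -> sumNN f l <= sumNN f l'.
Proof.
  intros H; revert l'; induction l as [|p l IH]; intros l' Hl Hi; simpl.
  - now apply sumNN_ge0.
  - destruct (in_split p l') as (a & b & ->); [apply Hi; now left|].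
    inversion Hl as [|? ? Hp Hl']; subst.
    assert (sumNN f l <= sumNN f (a ++ b)).
    { apply IH; auto. intros q Hq.
      assert (Hq' := Hi q (or_intror Hq)).
      apply in_app_or in Hq'; apply in_or_app.
      destruct Hq' as [|[->|]]; auto. contradiction. }
    rewrite sumNN_app in *; simpl; lra.
Qed.

(** This consequence of the parallelogram law replaces the triangle inequality and keeps square
    roots out of all estimates. *)
Lemma energy_add k x y l m :
  energy k (vadd x y) l m <= 2 * energy k x l m + 2 * energy k y l m.
Proof.
  unfold energy.
  assert (H1 : sumZ (fun z => Cnorm2 (fst (vadd x y) z)) l
    <= 2 * sumZ (fun z => Cnorm2 (fst x z)) l
       + 2 * sumZ (fun z => Cnorm2 (fst y z)) l).
  { induction l as [|z l IH]; simpl in *; [lra|].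
    generalize (Cnorm2_add (fst x z) (fst y z)); lra. }
  assert (H2 : forall f g h : nat -> nat -> R,
    (forall j n, f j n <= 2 * g j n + 2 * h j n) ->
    sumNN f m <= 2 * sumNN g m + 2 * sumNN h m).
  { intros f g h H. induction m as [|p m IH]; simpl; [lra|].
    specialize (H (fst p) (snd p)); lra. }
  eapply Rle_trans; [apply Rplus_le_compat; [exact H1|]|].
  - apply H2 with (g := fun j n => if (j <? k)%nat then Cnorm2 (snd x j n) else 0)
      (h := fun j n => if (j <? k)%nat then Cnorm2 (snd y j n) else 0).
    intros j n; destruct (j <? k)%nat; [apply Cnorm2_add|lra].
  - lra.
Qed.

Lemma norm2_le_add k x y A B :
  norm2_le k x A -> norm2_le k y B -> norm2_le k (vadd x y) (2 * A + 2 * B).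
Proof.
  intros Hx Hy l m Hl Hm.
  generalize (energy_add k x y l m) (Hx l m Hl Hm) (Hy l m Hl Hm); lra.
Qed.

Lemma energy_scale k c x l m :
  energy k (vscale c x) l m = Cnorm2 c * energy k x l m.
Proof.
  unfold energy; rewrite Rmult_plus_distr_l; f_equal.
  - induction l as [|z l IH]; simpl in *; [ring|]. rewrite IH, Cnorm2_mul; ring.
  - induction m as [|p m IH]; simpl in *; [ring|]. rewrite IH.
    destruct (fst p <? k)%nat; [rewrite Cnorm2_mul|]; ring.
Qed.

Lemma norm2_le_scale k c x A :
  norm2_le k x A -> norm2_le k (vscale c x) (Cnorm2 c * A).
Proof.
  intros Hx l m Hl Hm; rewrite energy_scale.
  apply Rmult_le_compat_l; [apply Cnorm2_ge0|auto].
Qed.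

Lemma norm2_le_ge0 k x A : norm2_le k x A -> 0 <= A.
Proof.
  intros H; generalize (H [] [] (NoDup_nil _) (NoDup_nil _)).
  unfold energy; simpl; lra.
Qed.

Lemma norm2_le_weaken k x A B : norm2_le k x A -> A <= B -> norm2_le k x B.
Proof. intros H HAB l m Hl Hm; specialize (H l m Hl Hm); lra. Qed.

Lemma norm2_le_zero k : norm2_le k vzero 0.
Proof.
  intros l m _ _; unfold energy.
  replace (sumZ _ l) with 0.
  2:{ induction l as [|z l IH]; simpl in *; [ring|]. rewrite <- IH.
      unfold Cnorm2; simpl; ring. }
  replace (sumNN _ m) with 0; [lra|].
  induction m as [|p m IH]; simpl in *; [ring|]. rewrite <- IH.
  destruct (fst p <? k)%nat; unfold Cnorm2; simpl; ring.
Qed.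

(** [Top] reindexes coordinates injectively, so each partial energy of [Top x] is one of [x] over
    translated index lists. *)
Lemma norm2_le_Top k x A : norm2_le k x A -> norm2_le k (Top x) A.
Proof.
  intros Hx l m Hl Hm.
  replace (energy k (Top x) l m) with
    (energy k x (map (fun z => (z - 1)%Z) l) (map (fun p => (fst p, S (snd p))) m)).
  - apply Hx; apply Injective_map_NoDup; auto.
    + intros a b; lia.
    + intros [a b] [c d]; simpl; intros E; injection E; intros -> ->; reflexivity.
  - unfold energy; f_equal.
    + clear; induction l as [|z l IH]; [|cbn [sumZ map]; rewrite IH]; reflexivity.
    + clear; induction m as [|p m IH]; [|cbn [sumNN map]; rewrite IH]; reflexivity.
Qed.

(** The two-sided powers of the bilateral shift; the second component is discarded because the
    backward shifts have no inverse. *)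
Definition zshift (n : Z) (x : vec) : vec :=
  (fun z => fst x (z - n)%Z, fun _ _ => C0).

Lemma norm2_le_zshift k n x A : norm2_le k x A -> norm2_le k (zshift n x) A.
Proof.
  intros Hx l m Hl Hm.
  replace (energy k (zshift n x) l m) with
    (energy k x (map (fun z => (z - n)%Z) l) []).
  - apply Hx; [|constructor]. apply Injective_map_NoDup; auto.
    intros a b; lia.
  - unfold energy; f_equal.
    + clear; induction l as [|z l IH]; [|cbn [sumZ map]; rewrite IH]; reflexivity.
    + clear; induction m as [|p m IH]; simpl in *; [reflexivity|]. rewrite <- IH.
      destruct (fst p <? k)%nat; unfold Cnorm2; simpl; ring.
Qed.

Lemma half_pow_pos n : 0 < (1/2)^n.
Proof. apply pow_lt; lra. Qed.

(** A duplicate-free list fits into a square grid, where rows and then columns are geometric sums,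
    each at most twice its first term. *)
Lemma sumNN_geometric m :
  NoDup m -> sumNN (fun j n => (1/2)^j * (1/2)^n) m <= 4.
Proof.
  intros Hm; set (f := fun j n => (1/2)^j * (1/2)^n).
  assert (Hf : forall j n, 0 <= f j n).
  { intros j n; unfold f; apply Rmult_le_pos; apply Rlt_le, half_pow_pos. }
  assert (row : forall N j s,
    sumNN f (map (pair j) (List.seq s N)) <= 2 * f j s).
  { induction N as [|N IH]; intros j s; simpl.
    - specialize (Hf j s); lra.
    - specialize (IH j (S s)); unfold f in *; simpl in *; lra. }
  assert (grid : forall N M s,
    sumNN f (list_prod (List.seq s M) (List.seq 0 N)) <= 2 * (2 * f s 0%nat)).
  { intros N; induction M as [|M IH]; intros s; simpl.
    - specialize (Hf s 0%nat); lra.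
    - rewrite sumNN_app; specialize (IH (S s)); specialize (row N s 0%nat).
      assert (f (S s) 0%nat = f s 0%nat / 2) by (unfold f; simpl; field).
      change (fun y : nat => (s, y)) with (pair s : nat -> nat * nat); lra. }
  assert (exists N, incl m (list_prod (List.seq 0 N) (List.seq 0 N))) as [N HN].
  { clear; induction m as [|[a b] m [N IH]].
    - exists 0%nat; intros p [].
    - exists (N + a + b + 1)%nat; intros p [<-|Hp].
      + apply in_prod; apply in_seq; lia.
      + specialize (IH p Hp); destruct p as [c d]; apply in_prod_iff in IH.
        destruct IH as [H1 H2]; apply in_seq in H1; apply in_seq in H2.
        apply in_prod; apply in_seq; lia. }
  eapply Rle_trans; [apply sumNN_incl; eassumption|].
  eapply Rle_trans; [apply grid|]. unfold f; simpl; lra.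
Qed.

(** The factor [2^k] pays for the missing decay in [j]: since [2^k * (1/2)^j >= 1] for [j < k], the
    double geometric series dominates. *)
Lemma norm2_le_dominated k x D :
  0 <= D -> (forall z, fst x z = C0) ->
  (forall j n, (j < k)%nat -> Cnorm2 (snd x j n) <= D * (1/2)^n) ->
  norm2_le k x (4 * 2^k * D).
Proof.
  intros HD H1 H2 l m _ Hm; unfold energy.
  replace (sumZ _ l) with 0.
  2:{ clear - H1; induction l as [|z l IH]; simpl in *; [ring|]. rewrite <- IH, H1.
      unfold Cnorm2; simpl; ring. }
  rewrite Rplus_0_l.
  apply Rle_trans with
    (sumNN (fun j n => (2^k * D) * ((1/2)^j * (1/2)^n)) m).
  - apply sumNN_le; intros j n.
    assert (0 < 2^k) by (apply pow_lt; lra).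
    assert (Hp := half_pow_pos n). assert (Hq := half_pow_pos j).
    destruct (Nat.ltb_spec j k) as [Hj|Hj].
    + specialize (H2 j n Hj).
      assert (1 <= 2^k * (1/2)^j).
      { replace k with ((k - j) + j)%nat by lia. rewrite pow_add, Rmult_assoc.
        rewrite <- Rpow_mult_distr. replace (2 * (1/2)) with 1 by lra.
        rewrite pow1, Rmult_1_r. apply pow_R1_Rle; lra. }
      replace (2^k * D * ((1/2)^j * (1/2)^n))
        with ((2^k * (1/2)^j) * (D * (1/2)^n)) by ring.
      assert (0 <= D * (1/2)^n) by nra. nra.
    + assert (0 <= 2^k * D) by nra. assert (0 <= (1/2)^j * (1/2)^n) by nra. nra.
  - rewrite sumNN_scal.
    replace (4 * 2^k * D) with (2^k * D * 4) by ring.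
    apply Rmult_le_compat_l; [|now apply sumNN_geometric].
    assert (0 < 2^k) by (apply pow_lt; lra). nra.
Qed.

(** * The closed span of the forward orbit as an invariant closed subspace *)

(** Here [eps] bounds a squared distance, whereas in [dist_lt] it bounds the distance itself. *)
Definition Reach (k : nat) (h x : vec) : Prop :=
  forall eps, 0 < eps -> exists N c, norm2_le k (vsub x (lincomb c h N)) eps.

(** Padding with zero coefficients brings two combinations to a common length, so that they can be
    added. *)
Lemma lincomb_extend c h N M : (N <= M)%nat ->
  lincomb c h N = lincomb (fun n => if (n <=? N)%nat then c n else C0) h M.
Proof.
  intros H; induction H as [|M H IH].
  - set (c' := fun n => if (n <=? N)%nat then c n else C0).
    assert (E : forall n, (n <= N)%nat -> c' n = c n).
    { intros n Hn; unfold c'. apply Nat.leb_le in Hn; now rewrite Hn. }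
    (* The length becomes a variable [n <= N], while the cutoff [N] inside [c'] stays fixed. *)
    generalize (le_n N); generalize N at 1 3 4; intros n.
    induction n as [|n IH]; intros Hn; simpl; rewrite E by lia; auto.
    rewrite IH by lia; reflexivity.
  - cbn [lincomb]; rewrite <- IH.
    replace (S M <=? N)%nat with false by (symmetry; apply Nat.leb_gt; lia).
    generalize (Tpow (S M) h); intros; veq.
Qed.

Lemma lincomb_add c d h N :
  vadd (lincomb c h N) (lincomb d h N) = lincomb (fun n => Cadd (c n) (d n)) h N.
Proof.
  induction N as [|N IH]; [veq|]. change (lincomb (fun n => Cadd (c n) (d n)) h (S N))
    with (vadd (lincomb (fun n => Cadd (c n) (d n)) h N)
           (vscale (Cadd (c (S N)) (d (S N))) (Tpow (S N) h))).
  rewrite <- IH; cbn [lincomb]; generalize (Tpow (S N) h); intros; veq.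
Qed.

Lemma lincomb_scale a c h N :
  vscale a (lincomb c h N) = lincomb (fun n => Cmul a (c n)) h N.
Proof.
  induction N as [|N IH]; [veq|]. change (lincomb (fun n => Cmul a (c n)) h (S N))
    with (vadd (lincomb (fun n => Cmul a (c n)) h N)
           (vscale (Cmul a (c (S N))) (Tpow (S N) h))).
  rewrite <- IH; cbn [lincomb]; generalize (Tpow (S N) h); intros; veq.
Qed.

Lemma lincomb_Top c h N :
  Top (lincomb c h N)
  = lincomb (fun n => match n with O => C0 | S n => c n end) h (S N).
Proof.
  induction N as [|N IH]; [veq|].
  set (d := fun n => match n with O => C0 | S n => c n end) in *.
  change (lincomb d h (S (S N)))
    with (vadd (lincomb d h (S N)) (vscale (c (S N)) (Top (Tpow (S N) h)))).
  rewrite <- IH; cbn [lincomb]; generalize (Tpow (S N) h); intros; veq.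
Qed.

Lemma reach_closed k h x :
  (forall eps, 0 < eps -> exists y, Reach k h y /\ norm2_le k (vsub x y) eps) ->
  Reach k h x.
Proof.
  intros H eps He.
  destruct (H (eps / 4)) as (y & Hy & Hxy); [lra|].
  destruct (Hy (eps / 4)) as (N & c & Hc); [lra|].
  exists N, c.
  replace (vsub x (lincomb c h N)) with (vadd (vsub x y) (vsub y (lincomb c h N)))
    by veq.
  eapply norm2_le_weaken; [apply norm2_le_add; eassumption|lra].
Qed.

Lemma reach_add k h x y : Reach k h x -> Reach k h y -> Reach k h (vadd x y).
Proof.
  intros Hx Hy eps He.
  destruct (Hx (eps / 4)) as (N & c & Hc); [lra|].
  destruct (Hy (eps / 4)) as (M & d & Hd); [lra|].
  rewrite (lincomb_extend c h N (N + M)) in Hc by lia.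
  rewrite (lincomb_extend d h M (N + M)) in Hd by lia.
  revert Hc Hd; generalize (fun n => if (n <=? N)%nat then c n else C0) as c'.
  generalize (fun n => if (n <=? M)%nat then d n else C0) as d'; intros d' c' Hc Hd.
  exists (N + M)%nat, (fun n => Cadd (c' n) (d' n)); rewrite <- lincomb_add.
  replace (vsub _ _) with
    (vadd (vsub x (lincomb c' h (N + M))) (vsub y (lincomb d' h (N + M)))) by veq.
  eapply norm2_le_weaken; [apply norm2_le_add; eassumption|lra].
Qed.

Lemma reach_scale k h a x : Reach k h x -> Reach k h (vscale a x).
Proof.
  intros Hx eps He. assert (Ha := Cnorm2_ge0 a).
  destruct (Hx (eps / (Cnorm2 a + 1))) as (N & c & Hc).
  { apply Rdiv_lt_0_compat; lra. }
  exists N, (fun n => Cmul a (c n)); rewrite <- lincomb_scale.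
  replace (vsub _ _) with (vscale a (vsub x (lincomb c h N))) by veq.
  eapply norm2_le_weaken; [apply norm2_le_scale; eassumption|].
  apply Rmult_le_reg_r with (Cnorm2 a + 1); [lra|].
  field_simplify; [|lra..]. nra.
Qed.

Lemma reach_sub k h x y : Reach k h x -> Reach k h y -> Reach k h (vsub x y).
Proof.
  intros Hx Hy. replace (vsub x y) with (vadd x (vscale (-1, 0) y)) by veq.
  apply reach_add; [|apply reach_scale]; assumption.
Qed.

Lemma reach_Top k h x : Reach k h x -> Reach k h (Top x).
Proof.
  intros Hx eps He. destruct (Hx eps He) as (N & c & Hc).
  exists (S N), (fun n => match n with O => C0 | S n => c n end); rewrite <- lincomb_Top.
  apply (norm2_le_Top _ (vsub x (lincomb c h N))); assumption.
Qed.

Lemma reach_self k h : Reach k h h.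
Proof.
  intros eps He; exists 0%nat, (fun _ => (1, 0)).
  replace (vsub _ _) with vzero by veq.
  eapply norm2_le_weaken; [apply norm2_le_zero|lra].
Qed.

Lemma reach_zero k h : Reach k h vzero.
Proof.
  replace vzero with (vscale C0 h) by veq. apply reach_scale, reach_self.
Qed.

(** * Basis vectors and finite truncations *)

Definition eZ (i : Z) : vec :=
  (fun z => if Z.eq_dec z i then (1, 0) else C0, fun _ _ => C0).
Definition eN (i p : nat) : vec :=
  (fun _ => C0,
   fun j n => if Nat.eq_dec j i then if Nat.eq_dec n p then (1, 0) else C0 else C0).

Definition pair_dec (p q : nat * nat) : {p = q} + {p <> q}.
Proof. decide equality; apply Nat.eq_dec. Defined.

Definition trunc (x : vec) (l : list Z) (m : list (nat * nat)) : vec :=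
  (fun z => if in_dec Z.eq_dec z l then fst x z else C0,
   fun j n => if in_dec pair_dec (j, n) m then snd x j n else C0).

(** Coordinates are added one at a time; an index already present in the rest of the list changes
    nothing, which is why each step splits on membership. *)
Lemma reach_trunc k h x l m :
  (forall z, Reach k h (vscale (fst x z) (eZ z))) ->
  (forall j n, Reach k h (vscale (snd x j n) (eN j n))) ->
  Reach k h (trunc x l m).
Proof.
  intros H1 H2; induction l as [|z l IH].
  - induction m as [|[j n] m IH].
    + apply reach_zero.
    + destruct (in_dec pair_dec (j, n) m) as [Hi|Hi].
      * replace (trunc x [] ((j, n) :: m)) with (trunc x [] m); [exact IH|].
        apply vec_ext; [reflexivity|]; intros a b; unfold trunc; cbn [snd].
        destruct (in_dec pair_dec (a, b) m) as [Ha|Ha],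
          (in_dec pair_dec (a, b) ((j, n) :: m)) as [Hb|Hb]; auto.
        -- destruct Hb; now right.
        -- destruct Hb as [E|]; [rewrite <- E in Ha|]; contradiction.
      * replace (trunc x [] ((j, n) :: m))
          with (vadd (trunc x [] m) (vscale (snd x j n) (eN j n)));
          [apply reach_add; auto|].
        apply vec_ext; [intros z; simpl; ceq|]; intros a b.
        unfold trunc, vadd, vscale, eN; cbn [snd].
        destruct (Nat.eq_dec a j) as [->|Ea]; [destruct (Nat.eq_dec b n) as [->|Eb]|].
        -- destruct (in_dec pair_dec (j, n) m) as [Ha|Ha]; [contradiction|].
           destruct (in_dec pair_dec (j, n) ((j, n) :: m)) as [Hb|Hb]; [ceq|].
           destruct Hb; now left.
        -- destruct (in_dec pair_dec (j, b) m) as [Ha|Ha],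
             (in_dec pair_dec (j, b) ((j, n) :: m)) as [Hb|Hb]; try solve [ceq].
           ++ destruct Hb; now right.
           ++ destruct Hb as [E|]; [congruence|contradiction].
        -- destruct (in_dec pair_dec (a, b) m) as [Ha|Ha],
             (in_dec pair_dec (a, b) ((j, n) :: m)) as [Hb|Hb]; try solve [ceq].
           ++ destruct Hb; now right.
           ++ destruct Hb as [E|]; [congruence|contradiction].
  - destruct (in_dec Z.eq_dec z l) as [Hi|Hi].
    + replace (trunc x (z :: l) m) with (trunc x l m); [exact IH|].
      apply vec_ext; [|reflexivity]; intros a; unfold trunc; cbn [fst].
      destruct (in_dec Z.eq_dec a l) as [Ha|Ha],
        (in_dec Z.eq_dec a (z :: l)) as [Hb|Hb]; auto.
      * destruct Hb; now right.
      * destruct Hb as [E|]; [rewrite <- E in Ha|]; contradiction.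
    + replace (trunc x (z :: l) m)
        with (vadd (trunc x l m) (vscale (fst x z) (eZ z)));
        [apply reach_add; auto|].
      apply vec_ext; [|intros j n; simpl; ceq]; intros a.
      unfold trunc, vadd, vscale, eZ; cbn [fst].
      destruct (Z.eq_dec a z) as [->|Ea].
      * destruct (in_dec Z.eq_dec z l) as [Ha|Ha]; [contradiction|].
        destruct (in_dec Z.eq_dec z (z :: l)) as [Hb|Hb]; [ceq|].
        destruct Hb; now left.
      * destruct (in_dec Z.eq_dec a l) as [Ha|Ha],
          (in_dec Z.eq_dec a (z :: l)) as [Hb|Hb]; try solve [ceq].
        -- destruct Hb; now right.
        -- destruct Hb as [E|]; [congruence|contradiction].
Qed.

Definition notin {A} (dec : forall a b : A, {a = b} + {a <> b}) (l : list A) (a : A) :=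
  if in_dec dec a l then false else true.

Lemma NoDup_app_notin {A} dec (l l' : list A) :
  NoDup l -> NoDup l' -> NoDup (l ++ filter (notin dec l) l').
Proof.
  intros Hl Hl'; apply NoDup_app; auto; [now apply NoDup_filter|].
  intros a Ha Hf; apply filter_In in Hf; destruct Hf as [_ Hf]; unfold notin in Hf.
  destruct (in_dec dec a l); [discriminate|contradiction].
Qed.

(** Subtracting the truncation makes the listed coordinates zero, so they may be filtered out of the
    test lists. *)
Lemma energy_residual k x l m l' m' :
  energy k (vsub x (trunc x l m)) l' m'
  = energy k x (filter (notin Z.eq_dec l) l') (filter (notin pair_dec m) m').
Proof.
  unfold energy; f_equal.
  - induction l' as [|z l' IH]; [reflexivity|].
    cbn [sumZ filter]; rewrite IH; unfold notin at 2; unfold vsub, trunc; cbn [fst].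
    destruct (in_dec Z.eq_dec z l); cbn [sumZ]; unfold Cnorm2; simpl; ring.
  - induction m' as [|[j n] m' IH]; [reflexivity|].
    cbn [sumNN filter]; rewrite IH; unfold notin at 2; unfold vsub, trunc; cbn [fst snd].
    destruct (in_dec pair_dec (j, n) m); cbn [sumNN fst snd];
      destruct (j <? k)%nat; unfold Cnorm2; simpl; ring.
Qed.

(* A partial energy close to the supremum leaves a small remainder. *)
Lemma trunc_approx k x B eps : norm2_le k x B -> 0 < eps ->
  exists l m, norm2_le k (vsub x (trunc x l m)) eps.
Proof.
  intros HB He.
  set (E := fun r => exists l m, NoDup l /\ NoDup m /\ r = energy k x l m).
  destruct (completeness E) as [s [Hs1 Hs2]].
  - exists B; intros r (l & m & Hl & Hm & ->); auto.
  - exists (energy k x [] []), [], []; repeat split; constructor.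
  - assert (exists l m, NoDup l /\ NoDup m /\ s - eps < energy k x l m)
      as (l & m & Hl & Hm & Hlm).
    { apply NNPP; intros Hn.
      assert (s <= s - eps); [|lra].
      apply Hs2; intros r (l & m & Hl & Hm & ->).
      apply Rnot_lt_le; intros Hlt; apply Hn; exists l, m; auto. }
    exists l, m; intros l' m' Hl' Hm'; rewrite energy_residual.
    assert (H : energy k x (l ++ filter (notin Z.eq_dec l) l')
                  (m ++ filter (notin pair_dec m) m') <= s).
    { apply Hs1; do 2 eexists; split; [|split; [|reflexivity]];
        now apply NoDup_app_notin. }
    unfold energy in *; rewrite sumZ_app, sumNN_app in H; lra.
Qed.

Lemma reach_of_coordinates k h x B : norm2_le k x B ->
  (forall z, Reach k h (vscale (fst x z) (eZ z))) ->
  (forall j n, Reach k h (vscale (snd x j n) (eN j n))) ->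
  Reach k h x.
Proof.
  intros HB H1 H2; apply reach_closed; intros eps He.
  destruct (trunc_approx k x B eps HB He) as (l & m & Hlm).
  exists (trunc x l m); split; [now apply reach_trunc|assumption].
Qed.

(** * Polynomials in the operator *)

(* Syntax trees, so that one polynomial can be evaluated both at the operator
   and at the points of the unit circle. *)
Inductive rpoly : Type :=
| Cst (r : R)
| Var
| Add (p q : rpoly)
| Mul (p q : rpoly).

Fixpoint act (p : rpoly) (x : vec) : vec :=
  match p with
  | Cst r => vscale (r, 0) x
  | Var => Top x
  | Add p q => vadd (act p x) (act q x)
  | Mul p q => act p (act q x)
  end.

Fixpoint at0 (p : rpoly) : R :=
  match p with
  | Cst r => r
  | Var => 0
  | Add p q => at0 p + at0 q
  | Mul p q => at0 p * at0 q
  end.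

Lemma act_add p x y : act p (vadd x y) = vadd (act p x) (act p y).
Proof.
  revert x y; induction p as [r| |p IHp q IHq|p IHp q IHq]; intros x y; cbn [act].
  - veq.
  - veq.
  - rewrite IHp, IHq; veq.
  - rewrite IHq, IHp; reflexivity.
Qed.

Lemma act_scale p c x : act p (vscale c x) = vscale c (act p x).
Proof.
  revert x; induction p as [r| |p IHp q IHq|p IHp q IHq]; intros x; cbn [act].
  - veq.
  - veq.
  - rewrite IHp, IHq; veq.
  - rewrite IHq, IHp; reflexivity.
Qed.

Lemma act_zshift p n x : act p (zshift n x) = zshift n (act p x).
Proof.
  revert x; induction p as [r| |p IHp q IHq|p IHp q IHq]; intros x; cbn [act].
  - veq.
  - apply vec_ext; intros; simpl; [f_equal; lia|reflexivity].
  - rewrite IHp, IHq; veq.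
  - rewrite IHq, IHp; reflexivity.
Qed.

(** The constant depends on the tree only; [1 <= K] allows it to serve as a divisor in the choice of
    amplitudes. *)
Lemma act_bounded k p :
  exists K, 1 <= K /\ forall x B, norm2_le k x B -> norm2_le k (act p x) (K * B).
Proof.
  induction p as [r| |p IHp q IHq|p IHp q IHq]; cbn [act].
  - exists (1 + r * r); split; [nra|]. intros x B H.
    assert (HB := norm2_le_ge0 _ _ _ H).
    eapply norm2_le_weaken; [apply norm2_le_scale; eassumption|].
    unfold Cnorm2; simpl; nra.
  - exists 1; split; [lra|]. intros x B H; rewrite Rmult_1_l.
    now apply norm2_le_Top.
  - destruct IHp as (P & HP1 & HP), IHq as (Q & HQ1 & HQ).
    exists (2 * P + 2 * Q); split; [lra|]. intros x B H.
    eapply norm2_le_weaken; [apply norm2_le_add; [apply HP|apply HQ]; eassumption|lra].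
  - destruct IHp as (P & HP1 & HP), IHq as (Q & HQ1 & HQ).
    exists (P * Q); split; [nra|]. intros x B H; rewrite Rmult_assoc; auto.
Qed.

Lemma reach_act k h p x : Reach k h x -> Reach k h (act p x).
Proof.
  revert x; induction p as [r| |p IHp q IHq|p IHp q IHq]; intros x H; cbn [act].
  - now apply reach_scale.
  - now apply reach_Top.
  - apply reach_add; auto.
  - auto.
Qed.

(** Division by the variable: if p = p(0) + z p' and q = q(0) + z q', then pq = p(0)q(0) + z (p q' +
    q(0) p'). *)
Lemma act_divide_Var p :
  exists q, forall x, act p x = vadd (vscale (at0 p, 0) x) (act q (Top x)).
Proof.
  induction p as [r| |p [p' IHp] q [q' IHq]|p [p' IHp] q [q' IHq]]; cbn [act at0].
  - exists (Cst 0); intros x; veq.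
  - exists (Cst 1); intros x; veq.
  - exists (Add p' q'); intros x; rewrite IHp, IHq; cbn [act]; veq.
  - exists (Add (Mul p q') (Mul (Cst (at0 q)) p')); intros x.
    rewrite IHq, act_add, act_scale, (IHp x); cbn [act]; veq.
Qed.

(** The span of the first [n] basis vectors of copy [j], which the backward shift leaves
    invariant. *)
Definition lower (j n : nat) (x : vec) : Prop :=
  (forall z, fst x z = C0) /\
  (forall j' n', j' <> j \/ (n <= n')%nat -> snd x j' n' = C0).

(** The backward shift is nilpotent on this space and kills the top coordinate, so that coordinate
    sees only the constant term of [p]. *)
Lemma act_lower p j n x : lower j (S n) x ->
  lower j (S n) (act p x) /\ snd (act p x) j n = Cmul (at0 p, 0) (snd x j n).
Proof.
  revert x; induction p as [r| |p IHp q IHq|p IHp q IHq]; intros x H; cbn [act at0].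
  - split; [|reflexivity]. destruct H as [H1 H2]; split.
    + intros z; simpl; rewrite H1; ceq.
    + intros j' n' H; simpl; rewrite H2 by assumption; ceq.
  - destruct H as [H1 H2]; split; [split|].
    + intros z; simpl; now rewrite H1.
    + intros j' n' H; simpl; apply H2; destruct H; [auto|right; lia].
    + simpl; rewrite H2 by (right; lia); ceq.
  - destruct (IHp x H) as [[P1 P2] P3], (IHq x H) as [[Q1 Q2] Q3]; split; [split|].
    + intros z; simpl; rewrite P1, Q1; ceq.
    + intros j' n' Hn; simpl; rewrite P2, Q2 by assumption; ceq.
    + simpl; rewrite P3, Q3; ceq.
  - destruct (IHq x H) as [Q1 Q2], (IHp _ Q1) as [P1 P2]; split; [assumption|].
    rewrite P2, Q2; ceq.
Qed.

Lemma lower_eN j n : lower j (S n) (eN j n).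
Proof.
  split; [reflexivity|]. intros j' n' H; simpl.
  destruct (Nat.eq_dec j' j); [|reflexivity].
  destruct (Nat.eq_dec n' n); [exfalso|reflexivity]. destruct H; lia.
Qed.

Lemma reach_lower k h j n x :
  (forall i, (i < n)%nat -> Reach k h (eN j i)) -> lower j n x -> Reach k h x.
Proof.
  revert x; induction n as [|n IH]; intros x H [L1 L2].
  - replace x with vzero; [apply reach_zero|].
    apply vec_ext; intros; simpl; symmetry; [apply L1|apply L2; right; lia].
  - set (y := vsub x (vscale (snd x j n) (eN j n))).
    replace x with (vadd y (vscale (snd x j n) (eN j n))) by (unfold y; veq).
    apply reach_add; [|apply reach_scale, H; lia].
    apply IH; [intros; apply H; lia|]. split; unfold y.
    + intros z; simpl; rewrite L1; ceq.
    + intros j' n' Hn; simpl. destruct (Nat.eq_dec j' j) as [->|Hj].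
      * destruct (Nat.eq_dec n' n) as [->|Hn']; [ceq|].
        rewrite L2 by (right; lia); ceq.
      * rewrite L2 by (left; assumption); ceq.
Qed.

(** * Attaching backward shifts to a cyclic vector of the bilateral shift *)

Lemma Tpow_coord s x :
  (forall z, fst (Tpow s x) z = fst x (z - Z.of_nat s)%Z) /\
  (forall j n, snd (Tpow s x) j n = snd x j (s + n)%nat).
Proof.
  induction s as [|s [IH1 IH2]]; split; intros.
  - simpl; f_equal; lia.
  - reflexivity.
  - change (Tpow (S s) x) with (Top (Tpow s x)); cbn [Top fst]; rewrite IH1; f_equal; lia.
  - change (Tpow (S s) x) with (Top (Tpow s x)); cbn [Top snd]; rewrite IH2; f_equal; lia.
Qed.

Lemma reach_Tpow k h s x : Reach k h x -> Reach k h (Tpow s x).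
Proof.
  intros H; induction s as [|s IH]; [exact H|]. now apply (reach_Top k h (Tpow s x)).
Qed.

(** In other words, [U] is a limit of real combinations of [Top U], [Top (Top U)] and so on. *)
Definition annihilable (k : nat) (U : vec) : Prop :=
  forall eps, 0 < eps -> exists p, at0 p = 1 /\ norm2_le k (act p U) eps.

(* The i-th amplitude is negligible against the (i-1)-st one even after the
   polynomial attached to the latter has been applied. *)
Fixpoint amp (K : nat -> R -> R) (i : nat) : R :=
  match i with
  | O => 1
  | S i => amp K i * ((1/2)^(3 * i + 1) / K i (amp K i))
  end.

Lemma half_pow_le1 n : (1/2)^n <= 1.
Proof. induction n as [|n IH]; simpl; [lra|]. generalize (half_pow_pos n); lra. Qed.

Lemma amp_pos K (K_ge1 : forall i a, 0 < a -> 1 <= K i a) i :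
  0 < amp K i.
Proof.
  induction i as [|i IH]; simpl; [lra|].
  apply Rmult_lt_0_compat; [assumption|].
  apply Rdiv_lt_0_compat; [apply half_pow_pos|].
  specialize (K_ge1 i _ IH); lra.
Qed.

(** The exponent splits as [3 * i + 1 = i + (2 * i + 1)]: the first part is the gain wanted at stage
    [i], the second bridges the gap from [i^2] to [(i+1)^2]. The factor [p] lies in [0,1], so
    squaring only lowers it. *)
Lemma amp_step K (K_ge1 : forall i a, 0 < a -> 1 <= K i a) i :
  amp K (S i) ^ 2 <= amp K i ^ 2 * (1/2)^i / K i (amp K i) * (1/2)^(2 * i + 1).
Proof.
  cbn [amp]. assert (Ha := amp_pos K K_ge1 i). assert (HK := K_ge1 i _ Ha).
  set (a := amp K i) in *. set (c := K i a) in *.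
  replace (3 * i + 1)%nat with (i + (2 * i + 1))%nat by lia. rewrite pow_add.
  set (p := (1/2)^i * (1/2)^(2 * i + 1) / c).
  replace (a^2 * (1/2)^i / c * (1/2)^(2 * i + 1)) with (a^2 * p)
    by (unfold p; field; lra).
  assert (0 < /c <= 1).
  { split; [apply Rinv_0_lt_compat; lra|].
    rewrite <- Rinv_1; apply Rinv_le_contravar; lra. }
  assert (0 <= p <= 1).
  { unfold p, Rdiv. generalize (half_pow_pos i) (half_pow_le1 i)
      (half_pow_pos (2 * i + 1)) (half_pow_le1 (2 * i + 1)); intros.
    assert (0 <= (1/2)^i * (1/2)^(2 * i + 1) <= 1) by (split; nra).
    split; nra. }
  rewrite Rpow_mult_distr. apply Rmult_le_compat_l; [nra|]. nra.
Qed.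

Lemma amp_step_weak K (K_ge1 : forall i a, 0 < a -> 1 <= K i a) i :
  amp K (S i) ^ 2 <= amp K i ^ 2 * (1/2)^(2 * i + 1).
Proof.
  eapply Rle_trans; [apply amp_step, K_ge1|].
  assert (Ha := amp_pos K K_ge1 i). assert (HK := K_ge1 i _ Ha).
  apply Rmult_le_compat_r; [apply Rlt_le, half_pow_pos|].
  apply Rmult_le_reg_r with (K i (amp K i)); [lra|].
  unfold Rdiv; rewrite Rmult_assoc, Rinv_l by lra.
  generalize (half_pow_le1 i) (half_pow_pos i); intros.
  rewrite Rmult_1_r. apply Rmult_le_compat; nra.
Qed.

(** One strong step at [m] gains the division by [K m (amp K m)]; the weak steps after it preserve
    this gain, and their exponents [2 * i + 1] telescope to the distance of the squares. *)
Lemma amp_tail K (K_ge1 : forall i a, 0 < a -> 1 <= K i a) m i d :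
  (m < i)%nat -> (i * i = m * m + d)%nat ->
  amp K i ^ 2 <= amp K m ^ 2 * (1/2)^m / K m (amp K m) * (1/2)^d.
Proof.
  intros H; revert d; induction H as [|i H IH]; intros d Hd.
  - replace d with (2 * m + 1)%nat by lia. apply amp_step, K_ge1.
  - eapply Rle_trans; [apply amp_step_weak, K_ge1|].
    assert (m * m <= i * i)%nat by nia.
    replace d with ((i * i - m * m) + (2 * i + 1))%nat by lia.
    rewrite (pow_add _ (i * i - m * m)), <- Rmult_assoc.
    apply Rmult_le_compat_r; [apply Rlt_le, half_pow_pos|]. apply IH; lia.
Qed.

Lemma amp_le K (K_ge1 : forall i a, 0 < a -> 1 <= K i a) i :
  amp K i ^ 2 <= (1/2)^(i * i).
Proof.
  induction i as [|i IH]; [simpl; lra|].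
  eapply Rle_trans; [apply amp_step_weak, K_ge1|].
  replace (S i * S i)%nat with (i * i + (2 * i + 1))%nat by lia.
  rewrite (pow_add _ (i * i)).
  apply Rmult_le_compat_r; [apply Rlt_le, half_pow_pos|assumption].
Qed.

(* Amplitude [a i] at position [i^2] of copy [i mod k]. *)
Definition lacunary (k : nat) (a : nat -> R) : nat -> nat -> C :=
  fun j n => let i := Nat.sqrt n in
    if Nat.eq_dec (i * i) n then if Nat.eq_dec (i mod k) j then (a i, 0) else C0
    else C0.

Lemma lacunary_square k a i : lacunary k a (i mod k) (i * i) = (a i, 0).
Proof.
  unfold lacunary; rewrite Nat.sqrt_square.
  destruct (Nat.eq_dec (i * i) (i * i)); [|contradiction].
  destruct (Nat.eq_dec (i mod k) (i mod k)); [reflexivity|contradiction].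
Qed.

Lemma lacunary_cases k a j n : lacunary k a j n = C0 \/
  exists i, (n = i * i)%nat /\ (j = i mod k)%nat /\ lacunary k a j n = (a i, 0).
Proof.
  unfold lacunary. destruct (Nat.eq_dec _ n) as [E|]; [|now left].
  destruct (Nat.eq_dec _ j) as [F|]; [right|now left].
  exists (Nat.sqrt n); auto.
Qed.

Lemma half_pow_small C eps : 0 < eps -> exists M, forall m, (M <= m)%nat ->
  C * (1/2)^m <= eps.
Proof.
  intros He.
  destruct (pow_lt_1_zero (1/2) ltac:(rewrite Rabs_pos_eq; lra) (eps / (Rabs C + 1)))
    as [M HM].
  { apply Rdiv_lt_0_compat; [assumption|]. generalize (Rabs_pos C); lra. }
  exists M; intros m Hm; specialize (HM m Hm).
  assert (Hp := half_pow_pos m). assert (HC := Rabs_pos C). assert (HC' := Rle_abs C).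
  rewrite Rabs_pos_eq in HM by lra.
  apply Rlt_div_r in HM; [|lra]. nra.
Qed.

Lemma coupled_vector k U B : (1 <= k)%nat ->
  norm2_le k U B -> (forall j n, snd U j n = C0) -> annihilable k U ->
  exists h, inH k h /\ (forall j n, (j < k)%nat -> Reach k h (eN j n)) /\ Reach k h U.
Proof.
  intros Hk HB HU Hann.
  (* The polynomial depends on the amplitude, and the next amplitude on the operator bound of that
     polynomial. Choosing for all pairs of index and amplitude at once breaks the circle; [(Var, 1)]
     is a dummy for non-positive amplitudes. *)
  assert (Hch : forall ia : nat * R, exists pK : rpoly * R, 0 < snd ia ->
    at0 (fst pK) = 1 /\ norm2_le k (act (fst pK) U) (snd ia ^ 2 * (1/2)^(fst ia)) /\
    1 <= snd pK /\
    forall x A, norm2_le k x A -> norm2_le k (act (fst pK) x) (snd pK * A)).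
  { intros [i a]; cbn [fst snd]. destruct (Rlt_dec 0 a) as [Ha|Ha].
    - destruct (Hann (a^2 * (1/2)^i)) as (p & Hp1 & Hp2).
      { apply Rmult_lt_0_compat; [now apply pow_lt|apply half_pow_pos]. }
      destruct (act_bounded k p) as (c & Hc1 & Hc2).
      exists (p, c); auto.
    - exists (Var, 1); intros; contradiction. }
  apply choice in Hch. destruct Hch as [pick Hpick].
  set (K := fun i a => snd (pick (i, a))).
  assert (K_ge1 : forall i a, 0 < a -> 1 <= K i a).
  { intros i a Ha; apply (Hpick (i, a)); assumption. }
  set (a := amp K). set (v := lacunary k a).
  assert (Hv : forall j n, Cnorm2 (v j n) <= 1 * (1/2)^n).
  { intros j n; rewrite Rmult_1_l.
    destruct (lacunary_cases k a j n) as [E|(i & E & _ & F)]; unfold v.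
    - rewrite E; unfold Cnorm2, C0; simpl. generalize (half_pow_pos n); lra.
    - rewrite F; unfold Cnorm2; simpl. subst n.
      generalize (amp_le K K_ge1 i); unfold a; simpl; lra. }
  set (V := (fun _ => C0, v) : vec). set (h := vadd U V).
  assert (HV : norm2_le k V (4 * 2^k * 1)).
  { apply norm2_le_dominated; [lra|reflexivity|]. intros j n _; apply Hv. }
  assert (He : forall j n, (j < k)%nat -> Reach k h (eN j n)).
  { intros j n Hj; induction n as [n IH] using lt_wf_ind.
    apply reach_closed; intros eps Heps.
    (* After division by [a m], the squared error is [2 * (1/2)^m] from [U] plus
       [8 * 2^k * 2^n * (1/2)^m] from the tail. *)
    destruct (half_pow_small (2 + 8 * 2^k * 2^n) eps Heps) as [M HM].
    (* Congruent to [j] modulo [k], so the [m]-th amplitude sits in copy [j], and large enough for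
       both [HM] and [n < m]. *)
    set (m := (j + (M + n + 1) * k)%nat).
    assert (Hmod : (m mod k = j)%nat).
    { unfold m; rewrite Nat.Div0.mod_add. now apply Nat.mod_small. }
    assert (Hm : (M + n + 1 <= m)%nat) by (unfold m; nia). clearbody m.
    specialize (HM m ltac:(lia)).
    assert (Ha : 0 < a m) by (apply amp_pos; assumption).
    destruct (Hpick (m, a m) Ha) as (Hp0 & HpU & _ & HpK).
    cbn [fst snd] in *. fold (K m (a m)) in HpK. set (p := fst (pick (m, a m))) in *.
    assert (HK := K_ge1 m _ Ha). set (c := K m (a m)) in *.
    set (s := (m * m - n)%nat).
    assert (Hs : (m * m = s + n)%nat) by (unfold s; nia). clearbody s.
    set (tail := (fun _ => C0, fun j' n' =>
      if Nat.eq_dec j' j then if Nat.eq_dec n' n then C0 else v j' (s + n')%nat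
      else v j' (s + n')%nat) : vec).
    assert (Htail : norm2_le k tail (4 * 2^k * (a m ^ 2 * (1/2)^m / c * 2^n))).
    { assert (HD : 0 <= a m ^ 2 * (1/2)^m / c).
      { apply Rmult_le_pos; [|apply Rlt_le, Rinv_0_lt_compat; lra].
        apply Rmult_le_pos; [apply pow2_ge_0|apply Rlt_le, half_pow_pos]. }
      assert (H2n : 0 < 2^n) by (apply pow_lt; lra).
      apply norm2_le_dominated; [nra|reflexivity|]. intros j' n' _.
      assert (Hz : Cnorm2 C0 <= a m ^ 2 * (1/2)^m / c * 2^n * (1/2)^n').
      { unfold Cnorm2, C0; simpl. generalize (half_pow_pos n'); intros.
        assert (0 <= a m ^ 2 * (1/2)^m / c * 2^n) by nra. simpl in *; nra. }
      assert (Hv' : (j' <> j \/ n' <> n) -> Cnorm2 (v j' (s + n')%nat)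
                    <= a m ^ 2 * (1/2)^m / c * 2^n * (1/2)^n').
      { intros Hne. unfold v.
        destruct (lacunary_cases k a j' (s + n')) as [E|(i & E & F & G)];
          [rewrite E; exact Hz|].
        (* Since [n < m], the shift length [s = m^2 - n] exceeds [(m-1)^2], so every amplitude
           before the [m]-th has been shifted out. *)
        rewrite G. assert (m <= i)%nat by nia.
        assert (m <> i).
        { intros <-. destruct Hne; [congruence|lia]. }
        assert (i * i = m * m + (i * i - m * m))%nat as Hd by nia.
        assert (Ht := amp_tail K K_ge1 m i _ ltac:(lia) Hd).
        fold a in Ht; fold c in Ht.
        replace n' with (n + (i * i - m * m))%nat by lia.
        rewrite pow_add.
        replace (a m ^ 2 * (1/2)^m / c * 2^n * ((1/2)^n * (1/2)^(i * i - m * m)))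
          with ((2^n * (1/2)^n) * (a m ^ 2 * (1/2)^m / c * (1/2)^(i * i - m * m)))
          by ring.
        rewrite <- Rpow_mult_distr. replace (2 * (1/2)) with 1 by lra.
        rewrite pow1, Rmult_1_l. unfold Cnorm2; simpl in *; lra. }
      simpl. destruct (Nat.eq_dec j' j); [destruct (Nat.eq_dec n' n)|]; auto. }
    (* The shift by [s] moves the [m]-th amplitude exactly to position [n] of copy [j]. *)
    assert (Hdec : Tpow s h = vadd (vadd (zshift (Z.of_nat s) U)
                                     (vscale (a m, 0) (eN j n))) tail).
    { destruct (Tpow_coord s h) as [T1 T2]; apply vec_ext.
      - intros z; rewrite T1; simpl; ceq.
      - intros j' n'; rewrite T2; simpl; rewrite HU.
        destruct (Nat.eq_dec j' j) as [->|]; [destruct (Nat.eq_dec n' n) as [->|]|];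
          try solve [ceq].
        unfold v. rewrite <- Hs, <- Hmod, lacunary_square. ceq. }
    set (E := act p (eN j n)).
    (* As [p] has constant term 1, the top coordinates cancel and only vectors covered by the
       induction hypothesis remain. *)
    assert (Hlow : Reach k h (vsub E (eN j n))).
    { apply reach_lower with (j := j) (n := n); [intros; apply IH; lia|].
      destruct (act_lower p j n (eN j n) (lower_eN j n)) as [[L1 L2] L3].
      fold E in L1, L2, L3. split.
      - intros z; simpl; rewrite L1; ceq.
      - intros j' n' Hn; cbn [vsub snd].
        destruct (Nat.eq_dec j' j) as [->|Hj'].
        + destruct (Nat.eq_dec n' n) as [->|Hn'].
          * rewrite L3, Hp0. ceq.
          * rewrite L2 by (right; lia). simpl. destruct (Nat.eq_dec j j); [|ceq].
            destruct (Nat.eq_dec n' n); [contradiction|ceq].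
        + rewrite L2 by (left; assumption). simpl.
          destruct (Nat.eq_dec j' j); [contradiction|ceq]. }
    exists (vsub (vscale (/ a m, 0) (act p (Tpow s h))) (vsub E (eN j n))); split.
    - apply reach_sub; [|exact Hlow].
      apply reach_scale, reach_act, reach_Tpow, reach_self.
    - rewrite Hdec, !act_add, act_scale, act_zshift. fold E.
      replace (vsub _ _) with (vscale (- / a m, 0)
        (vadd (zshift (Z.of_nat s) (act p U)) (act p tail))).
      2:{ generalize (zshift (Z.of_nat s) (act p U)) (act p tail) (eN j n); intros.
          veq; field; lra. }
      eapply norm2_le_weaken.
      { apply norm2_le_scale, norm2_le_add;
          [apply norm2_le_zshift, HpU|apply HpK, Htail]. }
      unfold Cnorm2; simpl fst; simpl snd.
      eapply Rle_trans; [|exact HM]. apply Req_le. field. lra. }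
  exists h; split; [split|split].
  - intros j n Hj; simpl. rewrite HU. unfold v.
    destruct (lacunary_cases k a j n) as [E|(i & _ & E & _)]; [rewrite E; ceq|].
    exfalso. assert (i mod k < k)%nat by (apply Nat.mod_upper_bound; lia). lia.
  - exists (2 * B + 2 * (4 * 2^k * 1)). now apply norm2_le_add.
  - exact He.
  (* All coordinate vectors of the copies are now reachable, hence so is [V], and it can be
     subtracted from [h]. *)
  - replace U with (vsub h V) by (unfold h; veq).
    apply reach_sub; [apply reach_self|].
    apply reach_of_coordinates with (B := 4 * 2^k * 1); [exact HV| |].
    + intros z; simpl. replace (vscale C0 (eZ z)) with vzero; [apply reach_zero|veq].
    + intros j n. destruct (Nat.lt_ge_cases j k) as [Hj|Hj].
      * apply reach_scale; auto.
      * simpl; unfold v.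
        destruct (lacunary_cases k a j n) as [E|(i & _ & E & _)].
        -- rewrite E. replace (vscale C0 (eN j n)) with vzero; [apply reach_zero|veq].
        -- exfalso. assert (i mod k < k)%nat by (apply Nat.mod_upper_bound; lia). lia.
Qed.

(** Backward steps: if p = 1 + z q nearly annihilates [U], it nearly annihilates every translate
    [y], so [y] is close to [- q(T) (T y)], where [T y] is the translate reached one step
    earlier. *)
Lemma reach_zshift k h U : (forall j n, snd U j n = C0) -> annihilable k U ->
  Reach k h U -> forall i, Reach k h (zshift i U).
Proof.
  intros HU Hann H.
  assert (Hneg : forall n, Reach k h (zshift (- Z.of_nat n) U)).
  { induction n as [|n IH].
    - replace (zshift _ U) with U; [assumption|].
      apply vec_ext; intros; simpl; [f_equal; lia|apply HU].
    - apply reach_closed; intros eps He.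
      destruct (Hann eps He) as (p & Hp0 & Hp).
      destruct (act_divide_Var p) as [q Hq].
      set (y := zshift (- Z.of_nat (S n)) U).
      assert (Hy : Top y = zshift (- Z.of_nat n) U).
      { apply vec_ext; intros; cbn [y zshift Top fst snd]; [f_equal; lia|reflexivity]. }
      exists (vscale (-1, 0) (act q (Top y))); split.
      + apply reach_scale, reach_act. now rewrite Hy.
      + replace (vsub _ _) with (act p y).
        * unfold y; rewrite act_zshift. now apply norm2_le_zshift.
        * rewrite Hq, Hp0. generalize (act q (Top y)); intros; veq. }
  intros i. destruct (Z.le_gt_cases 0 i) as [Hi|Hi].
  - rewrite <- (Z2Nat.id i) by assumption.
    replace (zshift _ U) with (Tpow (Z.to_nat i) U); [now apply reach_Tpow|].
    destruct (Tpow_coord (Z.to_nat i) U) as [T1 T2].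
    apply vec_ext; intros; [now rewrite T1|]. rewrite T2; apply HU.
  - replace i with (- Z.of_nat (Z.to_nat (- i)))%Z by lia. apply Hneg.
Qed.

(** * Fourier coefficients *)

Definition cont (f : R -> R) : Prop := forall x, continuous f x.

Lemma cont_const c : cont (fun _ => c).
Proof. intros x; apply continuous_const. Qed.

Lemma cont_add f g : cont f -> cont g -> cont (fun x => f x + g x).
Proof. intros Hf Hg x; apply (continuous_plus f g x); auto. Qed.

Lemma cont_mul f g : cont f -> cont g -> cont (fun x => f x * g x).
Proof. intros Hf Hg x; apply (continuous_mult f g x); auto. Qed.

Lemma cont_opp f : cont f -> cont (fun x => - f x).
Proof. intros Hf x; apply (continuous_opp f x); auto. Qed.

Lemma cont_sub f g : cont f -> cont g -> cont (fun x => f x - g x).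
Proof. intros Hf Hg; apply cont_add, cont_opp; assumption. Qed.

Lemma cont_cos c : cont (fun x => cos (c * x)).
Proof.
  intros x; apply (ex_derive_continuous (fun x => cos (c * x))).
  auto_derive; trivial.
Qed.

Lemma cont_sin c : cont (fun x => sin (c * x)).
Proof.
  intros x; apply (ex_derive_continuous (fun x => sin (c * x))).
  auto_derive; trivial.
Qed.

Lemma cont_ext f g : (forall x, f x = g x) -> cont f -> cont g.
Proof.
  intros H Hf; replace g with f; [assumption|]. apply functional_extensionality, H.
Qed.

Lemma cont_pow f n : cont f -> cont (fun x => f x ^ n).
Proof.
  intros Hf; induction n as [|n IH]; simpl; [apply cont_const|].
  now apply cont_mul.
Qed.

Create HintDb cont.
#[local] Hint Resolve cont_const cont_add cont_mul cont_opp cont_sub cont_cos cont_sin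
  cont_pow : cont.

Lemma cont_ex_RInt f a b : cont f -> ex_RInt f a b.
Proof. intros Hf; apply (ex_RInt_continuous f a b); intros; apply Hf. Qed.

Lemma int_add f g a b : cont f -> cont g ->
  RInt (fun x => f x + g x) a b = RInt f a b + RInt g a b.
Proof. intros Hf Hg; apply (RInt_plus f g); now apply cont_ex_RInt. Qed.

Lemma int_scal c f a b : cont f ->
  RInt (fun x => c * f x) a b = c * RInt f a b.
Proof. intros Hf; apply (RInt_scal f a b c); now apply cont_ex_RInt. Qed.

Lemma int_const c a b : RInt (fun _ => c) a b = (b - a) * c.
Proof. apply (RInt_const (V := R_CompleteNormedModule)). Qed.

Lemma int_cos_freq (j : Z) : j <> 0%Z -> RInt (fun x => cos (IZR j * x)) 0 (2 * PI) = 0.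
Proof.
  intros Hj. assert (Hj' : IZR j <> 0) by now apply not_0_IZR.
  apply is_RInt_unique.
  replace 0 with (minus (sin (IZR j * (2 * PI)) / IZR j) (sin (IZR j * 0) / IZR j)) at 2.
  - apply (is_RInt_derive (fun x => sin (IZR j * x) / IZR j)).
    + intros x _; auto_derive; [trivial|]. field; assumption.
    + intros x _; apply cont_cos.
  - rewrite Rmult_0_r, sin_0, (sin_eq_0_1 (IZR j * (2 * PI))).
    + unfold minus, plus, opp; simpl; field; assumption.
    + exists (j * 2)%Z; rewrite mult_IZR; ring.
Qed.

Definition Ccont (F : R -> C) : Prop :=
  cont (fun t => fst (F t)) /\ cont (fun t => snd (F t)).

Lemma Ccont_add F G : Ccont F -> Ccont G -> Ccont (fun t => Cadd (F t) (G t)).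
Proof. intros [F1 F2] [G1 G2]; split; simpl; auto with cont. Qed.

Lemma Ccont_mul F G : Ccont F -> Ccont G -> Ccont (fun t => Cmul (F t) (G t)).
Proof. intros [F1 F2] [G1 G2]; split; simpl; auto with cont. Qed.

Lemma Ccont_const c : Ccont (fun _ => c).
Proof. split; apply cont_const. Qed.

Definition mode (n : Z) (t : R) : C := (cos (IZR n * t), sin (IZR n * t)).

Lemma Ccont_mode n : Ccont (mode n).
Proof. split; simpl; auto with cont. Qed.

#[local] Hint Resolve Ccont_add Ccont_mul Ccont_const Ccont_mode : cont.

(* For a Laurent polynomial with real coefficients times a real even function
   this real part is the whole Fourier coefficient. *)
Definition coef (F : R -> C) (n : Z) : R :=
  RInt (fun t => fst (F t) * cos (IZR n * t) + snd (F t) * sin (IZR n * t)) 0 (2 * PI)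
  / (2 * PI).

Definition fourier (F : R -> C) : vec := (fun z => (coef F z, 0), fun _ _ => C0).

Lemma coef_cont F n : Ccont F ->
  cont (fun t => fst (F t) * cos (IZR n * t) + snd (F t) * sin (IZR n * t)).
Proof. intros [F1 F2]; auto with cont. Qed.

Lemma coef_int F n :
  RInt (fun t => fst (F t) * cos (IZR n * t) + snd (F t) * sin (IZR n * t)) 0 (2 * PI)
  = 2 * PI * coef F n.
Proof.
  assert (H : forall I : R, I = 2 * PI * (I / (2 * PI))).
  { assert (HP := PI_RGT_0); intros I; field; lra. }
  apply H.
Qed.

Lemma coef_add F G n : Ccont F -> Ccont G ->
  coef (fun t => Cadd (F t) (G t)) n = coef F n + coef G n.
Proof.
  intros HF HG; unfold coef, Rdiv; rewrite <- Rmult_plus_distr_r; f_equal.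
  rewrite <- int_add by now apply coef_cont.
  apply RInt_ext; intros t _; simpl; ring.
Qed.

Lemma coef_scal r F n : Ccont F ->
  coef (fun t => Cmul (r, 0) (F t)) n = r * coef F n.
Proof.
  intros HF; unfold coef, Rdiv; rewrite <- Rmult_assoc; f_equal.
  rewrite <- int_scal by now apply coef_cont.
  apply RInt_ext; intros t _; simpl; ring.
Qed.

Lemma coef_mode_mul i F n :
  coef (fun t => Cmul (mode i t) (F t)) n = coef F (n - i).
Proof.
  unfold coef; f_equal; apply RInt_ext; intros t _; simpl.
  rewrite minus_IZR, (Rmult_minus_distr_r (IZR n)), cos_minus, sin_minus; ring.
Qed.

Lemma coef_mode n m : coef (mode n) m = if Z.eq_dec n m then 1 else 0.
Proof.
  assert (HP := PI_RGT_0). unfold coef.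
  rewrite (RInt_ext _ (fun t => cos (IZR (n - m) * t))).
  - destruct (Z.eq_dec n m) as [->|Hn].
    + rewrite (RInt_ext _ (fun _ => 1)), int_const; [field; lra|].
      intros t _; rewrite Z.sub_diag, Rmult_0_l; apply cos_0.
    + rewrite int_cos_freq by lia. field; lra.
  - intros t _; simpl; rewrite minus_IZR, (Rmult_minus_distr_r (IZR n)), cos_minus; ring.
Qed.

Lemma Cnorm2_cont F : Ccont F -> cont (fun t => Cnorm2 (F t)).
Proof. intros [F1 F2]; unfold Cnorm2; auto with cont. Qed.

(* Bessel: the coefficients are removed one frequency at a time. *)
Lemma bessel_residual F l : Ccont F -> NoDup l ->
  exists G, Ccont G /\ (forall m, ~ In m l -> coef G m = coef F m) /\
    RInt (fun t => Cnorm2 (G t)) 0 (2 * PI)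
    = RInt (fun t => Cnorm2 (F t)) 0 (2 * PI)
      - 2 * PI * sumZ (fun z => coef F z * coef F z) l :> R.
Proof.
  intros HF; induction l as [|n l IH]; intros Hl.
  - exists F; split; [assumption|split; [reflexivity|cbn [sumZ]; now rewrite Rmult_0_r, Rminus_0_r]].
  - inversion Hl as [|? ? Hn Hl']; subst.
    destruct (IH Hl') as (G & HG & HGc & HGi).
    set (c := coef F n).
    exists (fun t => Cadd (G t) (Cmul (- c, 0) (mode n t))); split; [|split].
    + auto with cont.
    + intros m Hm. rewrite coef_add, coef_scal, coef_mode by auto with cont.
      rewrite HGc by (intros H; apply Hm; now right).
      destruct (Z.eq_dec n m) as [->|]; [destruct Hm; now left|ring].
    + rewrite (RInt_ext _ (fun t => Cnorm2 (G t) + ((-2 * c) *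
        (fst (G t) * cos (IZR n * t) + snd (G t) * sin (IZR n * t)) + c * c))).
      * assert (Hc := coef_cont G n HG). assert (Hq := Cnorm2_cont G HG).
        rewrite int_add, HGi, int_add, int_scal, int_const by auto with cont.
        (* Removing the other frequencies has left the coefficient at [n] unchanged, because [n] is
           not in [l]. *)
        assert (E : RInt (fun t => fst (G t) * cos (IZR n * t)
                     + snd (G t) * sin (IZR n * t)) 0 (2 * PI) = 2 * PI * c).
        { unfold c; rewrite <- HGc by assumption; apply coef_int. }
        rewrite E. cbn [sumZ]. fold c.
        ring.
      * intros t _. unfold Cnorm2, Cadd, Cmul, mode; simpl.
        generalize (sin2_cos2 (IZR n * t)); unfold Rsqr; intros E.
        transitivity (fst (G t) * fst (G t) + snd (G t) * snd (G t)
          + (-2 * c * (fst (G t) * cos (IZR n * t) + snd (G t) * sin (IZR n * t))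
          + c * c * (sin (IZR n * t) * sin (IZR n * t)
                     + cos (IZR n * t) * cos (IZR n * t)))); [ring|].
        rewrite E; ring.
Qed.

(** Bessel's inequality: the square integral of the residual function is non-negative. *)
Lemma norm2_le_fourier k F B : Ccont F ->
  RInt (fun t => Cnorm2 (F t)) 0 (2 * PI) <= 2 * PI * B -> norm2_le k (fourier F) B.
Proof.
  intros HF HB l m Hl _. assert (HP := PI_RGT_0).
  destruct (bessel_residual F l HF Hl) as (G & HG & _ & HGi).
  assert (0 <= RInt (fun t => Cnorm2 (G t)) 0 (2 * PI)).
  { apply RInt_ge_0; [lra|apply cont_ex_RInt, Cnorm2_cont, HG|].
    intros; apply Cnorm2_ge0. }
  unfold energy.
  replace (sumNN _ m) with 0.
  2:{ clear; induction m as [|p m IH]; simpl in *; [ring|]. rewrite <- IH.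
      destruct (fst p <? k)%nat; unfold Cnorm2; simpl; ring. }
  replace (sumZ (fun z => Cnorm2 (fst (fourier F) z)) l)
    with (sumZ (fun z => coef F z * coef F z) l).
  2:{ clear; induction l as [|z l IH]; [reflexivity|].
      cbn [sumZ]; rewrite IH; unfold Cnorm2; simpl; ring. }
  apply Rmult_le_reg_l with (2 * PI); lra.
Qed.

Lemma norm2_le_fourier_sup k F B : Ccont F ->
  (forall t, Cnorm2 (F t) <= B) -> norm2_le k (fourier F) B.
Proof.
  intros HF HB; assert (HP := PI_RGT_0). apply norm2_le_fourier; [assumption|].
  assert (E : RInt (fun _ => B) 0 (2 * PI) = 2 * PI * B :> R)
    by (rewrite int_const; ring).
  rewrite <- E.
  apply RInt_le;
    [lra|apply cont_ex_RInt, Cnorm2_cont, HF|apply cont_ex_RInt, cont_const|].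
  auto.
Qed.

Lemma fourier_add F G : Ccont F -> Ccont G ->
  fourier (fun t => Cadd (F t) (G t)) = vadd (fourier F) (fourier G).
Proof.
  intros HF HG; apply vec_ext; intros; simpl; [rewrite coef_add by assumption|]; ceq.
Qed.

Lemma fourier_scal r F : Ccont F ->
  fourier (fun t => Cmul (r, 0) (F t)) = vscale (r, 0) (fourier F).
Proof.
  intros HF; apply vec_ext; intros; simpl; [rewrite coef_scal by assumption|]; ceq.
Qed.

Lemma fourier_mode i F : fourier (fun t => Cmul (mode i t) (F t)) = zshift i (fourier F).
Proof. apply vec_ext; intros; simpl; [rewrite coef_mode_mul|]; reflexivity. Qed.

Fixpoint cev (p : rpoly) (t : R) : C :=
  match p with
  | Cst r => (r, 0)
  | Var => mode 1 t
  | Add p q => Cadd (cev p t) (cev q t)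
  | Mul p q => Cmul (cev p t) (cev q t)
  end.

Lemma Ccont_cev p : Ccont (cev p).
Proof.
  induction p; cbn [cev]; auto with cont.
Qed.

Lemma cev_bounded p : exists M, 0 <= M /\ forall t, Cnorm2 (cev p t) <= M.
Proof.
  induction p as [r| |p (P & HP & IHp) q (Q & HQ & IHq)|p (P & HP & IHp) q (Q & HQ & IHq)];
    cbn [cev].
  - exists (Cnorm2 (r, 0)); split; [apply Cnorm2_ge0|intros; lra].
  - exists 1; split; [lra|]. intros t; unfold Cnorm2; simpl.
    generalize (sin2_cos2 (1 * t)); unfold Rsqr; lra.
  - exists (2 * P + 2 * Q); split; [lra|]. intros t.
    generalize (Cnorm2_add (cev p t) (cev q t)) (IHp t) (IHq t); lra.
  - exists (P * Q); split; [nra|]. intros t; rewrite Cnorm2_mul.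
    apply Rmult_le_compat; auto using Cnorm2_ge0.
Qed.

(** Multiplication by [mode 1] translates Fourier coefficients by one, so norm estimates for [act p]
    reduce to pointwise bounds on the circle. *)
Lemma act_fourier p F : Ccont F ->
  act p (fourier F) = fourier (fun t => Cmul (cev p t) (F t)).
Proof.
  revert F; induction p as [r| |p IHp q IHq|p IHp q IHq]; intros F HF; cbn [act cev].
  - now rewrite fourier_scal.
  - rewrite (fourier_mode 1). reflexivity.
  - assert (Hp := Ccont_cev p). assert (Hq := Ccont_cev q).
    rewrite IHp, IHq, <- fourier_add by auto with cont. f_equal.
    apply functional_extensionality; intros t; ceq.
  - assert (Hp := Ccont_cev p). assert (Hq := Ccont_cev q).
    rewrite IHq, IHp by auto with cont. f_equal.
    apply functional_extensionality; intros t; ceq.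
Qed.

(** * A function with non-integrable logarithm *)

Definition hav (t : R) : R := (1 - cos t) / 2.

(** Chosen so flat at 0 that the logarithm of [bump (hav t)], namely [- / hav t], behaves like
    -4/t^2 near 0 and is not integrable. *)
Definition bump (s : R) : R := if Rlt_dec 0 s then exp (- / s) else 0.

Lemma hav_bounds t : 0 <= hav t <= 1.
Proof. unfold hav; generalize (COS_bound t); lra. Qed.

Lemma bump_le s : 0 <= s -> 0 <= bump s <= s.
Proof.
  intros Hs; unfold bump; destruct (Rlt_dec 0 s) as [H|H]; [|lra].
  split; [apply Rlt_le, exp_pos|].
  rewrite exp_Ropp. rewrite <- (Rinv_inv s) at 2.
  assert (0 < / s) by now apply Rinv_0_lt_compat.
  apply Rinv_le_contravar; [assumption|].
  generalize (exp_ineq1_le (/ s)); lra.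
Qed.

Lemma cont_bump : cont bump.
Proof.
  intros s; destruct (Rtotal_order s 0) as [Hs|[->|Hs]].
  - apply continuous_ext_loc with (fun _ => 0); [|apply continuous_const].
    exists (mkposreal (- s) ltac:(lra)); intros y Hy.
    unfold ball in Hy; simpl in Hy; unfold AbsRing_ball, abs, minus, plus, opp in Hy;
      simpl in Hy.
    apply Rabs_lt_between in Hy; unfold bump; destruct (Rlt_dec 0 y); lra.
  - apply continuity_pt_filterlim; intros eps He; exists eps; split; [assumption|].
    intros y [_ Hy]; simpl in *; unfold R_dist in *. rewrite Rminus_0_r in Hy.
    assert (E : bump 0 = 0) by (unfold bump; destruct (Rlt_dec 0 0); lra).
    rewrite E, Rminus_0_r. apply Rabs_lt_between in Hy.
    destruct (Rle_lt_dec 0 y) as [H|H].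
    + generalize (bump_le y H); intros; rewrite Rabs_pos_eq; lra.
    + unfold bump; destruct (Rlt_dec 0 y); [lra|]. rewrite Rabs_R0; assumption.
  - apply continuous_ext_loc with (fun s => exp (- / s)).
    + exists (mkposreal s Hs); intros y Hy.
      unfold ball in Hy; simpl in Hy; unfold AbsRing_ball, abs, minus, plus, opp in Hy;
        simpl in Hy.
      apply Rabs_lt_between in Hy; unfold bump; destruct (Rlt_dec 0 y); lra.
    + apply (ex_derive_continuous (fun s => exp (- / s))). auto_derive; lra.
Qed.

Lemma cont_hav : cont hav.
Proof.
  apply cont_ext with (fun t => / 2 * (1 - cos (1 * t))); [|auto with cont].
  intros t; unfold hav; rewrite Rmult_1_l; field.
Qed.

Definition weight (t : R) : C := (bump (hav t), 0).

Lemma Ccont_weight : Ccont weight.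
Proof.
  split; simpl; [|apply cont_const]. intros t.
  apply (continuous_comp hav bump); [apply cont_hav|apply cont_bump].
Qed.

#[local] Hint Resolve cont_hav Ccont_weight Ccont_cev : cont.

(** * Fejer polynomials and near annihilation of the weight *)

Fixpoint rpow (p : rpoly) (N : nat) : rpoly :=
  match N with O => Cst 1 | S N => Mul p (rpow p N) end.

Lemma at0_rpow p N : at0 (rpow p N) = at0 p ^ N.
Proof. induction N as [|N IH]; simpl; [|rewrite IH]; reflexivity. Qed.

Lemma Cnorm2_rpow p N t : Cnorm2 (cev (rpow p N) t) = Cnorm2 (cev p t) ^ N.
Proof.
  induction N as [|N IH]; simpl; [unfold Cnorm2; simpl; ring|].
  now rewrite Cnorm2_mul, IH.
Qed.

Lemma cev_rpow_Var n t : cev (rpow Var n) t = mode (Z.of_nat n) t.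
Proof.
  induction n as [|n IH]; cbn [rpow cev].
  - unfold mode; simpl; now rewrite Rmult_0_l, cos_0, sin_0.
  - rewrite IH; unfold mode, Cmul; cbn [fst snd].
    rewrite Nat2Z.inj_succ, succ_IZR, Rmult_plus_distr_r, cos_plus, sin_plus.
    f_equal; ring.
Qed.

(** The polynomial 1 + 2z + ... + 2z^n, whose real part on the unit circle is the Dirichlet
    kernel. *)
Fixpoint dirichlet (n : nat) : rpoly :=
  match n with
  | O => Cst 1
  | S n' => Add (dirichlet n') (Mul (Cst 2) (rpow Var n))
  end.

(* On the unit circle the real part is [n] times the Fejer kernel. *)
Fixpoint fejer (n : nat) : rpoly :=
  match n with O => Cst 0 | S n => Add (fejer n) (dirichlet n) end.

Lemma at0_dirichlet n : at0 (dirichlet n) = 1.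
Proof.
  induction n as [|n IH]; [reflexivity|]. cbn [dirichlet at0 rpow]; rewrite IH; ring.
Qed.

Lemma at0_fejer n : at0 (fejer n) = INR n.
Proof.
  induction n as [|n IH]; [reflexivity|]. cbn [fejer at0].
  rewrite IH, at0_dirichlet, S_INR; ring.
Qed.

(** With y = (n+1)t, a new term contributes 2 cos y (1 - cos t) = 2 cos y - cos(y-t) - cos(y+t). The
    difference form makes the sum in [Re_fejer] telescope. *)
Lemma Re_dirichlet n t :
  fst (cev (dirichlet n) t) * (1 - cos t)
  = cos (IZR (Z.of_nat n) * t) - cos (IZR (Z.of_nat (S n)) * t).
Proof.
  induction n as [|n IH].
  - simpl; rewrite Rmult_0_l, cos_0, !Rmult_1_l; ring.
  - cbn [dirichlet]. set (c := cev (rpow Var (S n)) t).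
    assert (Hc : c = mode (Z.of_nat (S n)) t) by apply cev_rpow_Var.
    cbn [cev]. fold c; rewrite Hc; unfold Cadd, Cmul, mode; cbn [fst snd].
    rewrite Rmult_plus_distr_r, IH, !Nat2Z.inj_succ, !succ_IZR.
    set (y := (IZR (Z.of_nat n) + 1) * t).
    replace (IZR (Z.of_nat n) * t) with (y - t) by (unfold y; ring).
    replace ((IZR (Z.of_nat n) + 1 + 1) * t) with (y + t) by (unfold y; ring).
    rewrite cos_minus, cos_plus; ring.
Qed.

Lemma Re_fejer n t :
  fst (cev (fejer n) t) * (1 - cos t) = 1 - cos (IZR (Z.of_nat n) * t).
Proof.
  induction n as [|n IH].
  - simpl; rewrite !Rmult_0_l, cos_0; ring.
  - cbn [fejer cev Cadd fst]. rewrite Rmult_plus_distr_r, IH, Re_dirichlet; ring.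
Qed.

(** Multiplied by [hav t], the left side is (1 - cos(nt))/2, at most 1. The bound is uniform in [n],
    while the constant term [n] grows. *)
Lemma Re_fejer_le n t : 0 < hav t -> fst (cev (fejer n) t) <= / hav t.
Proof.
  intros Ht; apply Rmult_le_reg_r with (hav t); [assumption|].
  rewrite Rinv_l by lra. unfold hav.
  generalize (Re_fejer n t) (COS_bound (IZR (Z.of_nat n) * t)); lra.
Qed.

Lemma exp_pow x n : exp x ^ n = exp (INR n * x).
Proof.
  induction n as [|n IH]; [simpl; now rewrite Rmult_0_l, exp_0|].
  cbn [pow]; rewrite IH, <- exp_plus, S_INR; f_equal; ring.
Qed.

Lemma exp_monotone x y : x <= y -> exp x <= exp y.
Proof. intros [H| ->]; [apply Rlt_le, exp_increasing, H|lra]. Qed.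

(* [(1 + w/N)^N] replaces [exp w]. *)
Lemma Cnorm2_compound a b N : (0 < N)%nat ->
  Cnorm2 (Cadd (1, 0) (Cmul (/ INR N, 0) (a, b))) ^ N
  <= exp (2 * a + Cnorm2 (a, b) / INR N).
Proof.
  intros HN; apply lt_0_INR in HN.
  replace (2 * a + Cnorm2 (a, b) / INR N)
    with (INR N * (2 * a / INR N + Cnorm2 (a, b) / (INR N * INR N)))
    by (field; lra).
  rewrite <- exp_pow. apply pow_incr; split; [apply Cnorm2_ge0|].
  eapply Rle_trans; [|apply exp_ineq1_le].
  apply Req_le; unfold Cnorm2; simpl; field; lra.
Qed.

(** Since [w] has constant term 0, the compound power has constant term 1. With s = [hav t] > 0, the
    squared modulus of its product with the weight is at most exp(2(1/s - n) + 1 - 2/s) = exp(1 -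
    2n). *)
Lemma annihilable_weight k : annihilable k (fourier weight).
Proof.
  intros eps He.
  destruct (nfloor_ex (/ eps)) as [n0 Hn0]; [apply Rlt_le, Rinv_0_lt_compat, He|].
  (* This suffices because exp(2n - 1) >= 2n > 1/eps. *)
  set (n := S n0). assert (Hn : / eps < INR n) by (unfold n; rewrite S_INR; lra).
  set (w := Add (fejer n) (Cst (- INR n))).
  destruct (cev_bounded w) as (M & HM & Hw).
  destruct (nfloor_ex M HM) as [N0 HN0].
  (* An exponent above the supremum of the squared modulus of [w] keeps the compounding correction
     in the exponent at most 1. *)
  set (N := S N0). assert (HN : M < INR N) by (unfold N; rewrite S_INR; lra).
  exists (rpow (Add (Cst 1) (Mul (Cst (/ INR N)) w)) N); split.
  - rewrite at0_rpow; unfold w; cbn [at0]; rewrite at0_fejer.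
    replace (1 + / INR N * (INR n + - INR n)) with 1 by ring. apply pow1.
  - rewrite act_fourier by auto with cont.
    apply norm2_le_fourier_sup; [auto with cont|]. intros t.
    rewrite Cnorm2_mul, Cnorm2_rpow.
    assert (Hi : 0 < / eps) by now apply Rinv_0_lt_compat.
    unfold weight, bump; destruct (Rlt_dec 0 (hav t)) as [Ht|Ht].
    2:{ unfold Cnorm2 at 2; simpl fst; simpl snd. lra. }
    assert (Hre := Re_fejer_le n t Ht). specialize (Hw t).
    set (a := fst (cev w t)). set (b := snd (cev w t)).
    assert (Ha : a <= / hav t - INR n) by (unfold a, w; cbn [cev Cadd fst]; lra).
    assert (Eab : cev w t = (a, b)) by (unfold a, b; now destruct (cev w t)).
    cbn [cev]. rewrite Eab in *.
    assert (HNn : (0 < N)%nat) by (unfold N; lia).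
    eapply Rle_trans.
    { apply Rmult_le_compat_r; [apply Cnorm2_ge0|]. now apply Cnorm2_compound. }
    unfold Cnorm2 at 2; simpl fst; simpl snd.
    rewrite Rmult_0_l, Rplus_0_r, <- !exp_plus.
    assert (Hdiv : Cnorm2 (a, b) / INR N <= 1).
    { apply Rle_div_l; lra. }
    apply Rle_trans with (exp (- (2 * INR n - 1))).
    { apply exp_monotone; lra. }
    rewrite exp_Ropp, <- (Rinv_inv eps).
    apply Rinv_le_contravar; [assumption|].
    generalize (exp_ineq1_le (2 * INR n - 1)); lra.
Qed.

(** * Approximate inversion of the weight *)

Fixpoint geo (s : R) (J : nat) : R :=
  match J with O => 0 | S J => geo s J + s ^ J end.

Lemma geo_sum s J : (1 - s) * geo s J = 1 - s ^ J.
Proof. induction J as [|J IH]; simpl; [ring|]. rewrite Rmult_plus_distr_l, IH; ring. Qed.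

Lemma geo_bounds s J : 0 <= s <= 1 -> 0 <= geo s J <= INR J.
Proof.
  intros Hs; induction J as [|J IH]; [simpl; lra|]. rewrite S_INR; cbn [geo].
  assert (0 <= s ^ J <= 1); [|lra].
  split; [apply pow_le; lra|]. rewrite <- (pow1 J); apply pow_incr; lra.
Qed.

(** A Bernoulli-type bound, by (1-s)(1+(J+1)s) <= 1+Js; it controls the remainder of the geometric
    series for 1/s. *)
Lemma pow_one_minus_le s J : 0 <= s <= 1 -> (1 - s) ^ J * (1 + INR J * s) <= 1.
Proof.
  intros Hs; induction J as [|J IH]; [simpl; lra|].
  rewrite S_INR; cbn [pow]. assert (0 <= (1 - s) ^ J) by (apply pow_le; lra).
  assert (0 <= INR J) by apply pos_INR.
  assert ((1 - s) * (1 + (INR J + 1) * s) <= 1 + INR J * s) by nra. nra.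
Qed.

Lemma compound_le_exp y n : 0 <= y -> (1 + y) ^ n <= exp (INR n * y).
Proof.
  intros Hy; rewrite <- exp_pow; apply pow_incr; split; [lra|apply exp_ineq1_le].
Qed.

Lemma exp_le_compound y n : 0 <= y -> exp (INR n * (y - y * y)) <= (1 + y) ^ n.
Proof.
  intros Hy; rewrite <- exp_pow; apply pow_incr; split; [apply Rlt_le, exp_pos|].
  assert (H := exp_ineq1_le (- (y - y * y))).
  assert (He := exp_pos (y - y * y)).
  rewrite exp_Ropp in H.
  (* The product equals 1 + y^3; this gives exp(y - y^2) <= 1 + y. *)
  assert (1 <= (1 + y) * (1 + - (y - y * y))) by nra.
  assert (1 <= (1 + y) * / exp (y - y * y)) by nra.
  apply Rmult_le_reg_r with (/ exp (y - y * y)); [now apply Rinv_0_lt_compat|].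
  rewrite Rinv_r by lra. assumption.
Qed.

(* A polynomial in [s] imitating [exp (1/s)]: [1/s] is replaced by a geometric
   sum, and [exp] by a compound power with so large an exponent that its error
   is negligible against that of the sum. *)
Definition invq (J : nat) (s : R) : R :=
  (1 + / INR (J * J * J) * geo (1 - s) J) ^ (J * J * J).

Lemma bump_pos s : 0 < s -> bump s = exp (- / s).
Proof. intros H; unfold bump; destruct (Rlt_dec 0 s); [reflexivity|lra]. Qed.

Lemma INR_cube_pos J : (0 < J)%nat -> 0 < INR (J * J * J).
Proof. intros H; apply lt_0_INR; nia. Qed.

(** The geometric sum stays below 1/s and the compound power below the exponential; at s = 0 the
    factor [bump] vanishes. *)
Lemma invq_bump_bounds J s : (0 < J)%nat -> 0 <= s <= 1 ->
  0 <= invq J s * bump s <= 1.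
Proof.
  intros HJ Hs. assert (HN := INR_cube_pos J HJ).
  assert (Hg := geo_bounds (1 - s) J ltac:(lra)).
  assert (HI : 0 < / INR (J * J * J)) by now apply Rinv_0_lt_compat.
  assert (Hy : 0 <= / INR (J * J * J) * geo (1 - s) J) by nra.
  assert (Hb := bump_le s ltac:(lra)).
  split; [apply Rmult_le_pos; [apply pow_le; lra|lra]|].
  destruct (Rle_lt_or_eq_dec 0 s) as [H0|<-]; [lra| |].
  - rewrite bump_pos by assumption. unfold invq.
    eapply Rle_trans.
    { apply Rmult_le_compat_r; [apply Rlt_le, exp_pos|].
      apply compound_le_exp; assumption. }
    rewrite <- Rmult_assoc, Rinv_r, Rmult_1_l, <- exp_plus by lra.
    assert (Hle : geo (1 - s) J + - / s <= 0).
    { assert (E := geo_sum (1 - s) J).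
      assert (0 <= (1 - s) ^ J) by (apply pow_le; lra).
      apply Rmult_le_reg_l with s; [assumption|].
      rewrite Rmult_plus_distr_l, Ropp_mult_distr_r_reverse, Rinv_r by lra. lra. }
    apply exp_monotone in Hle; now rewrite exp_0 in Hle.
  - replace (bump 0) with 0 by lra. lra.
Qed.

(** Two losses in the exponent: compounding costs r^2/J^3 <= 1/J because r <= J, and the truncated
    series costs (1-s)^J/s <= 1/(s^2 J). Then exp x >= 1 + x finishes. *)
Lemma invq_bump_near1 J c s : (0 < J)%nat -> 0 < c -> c <= s <= 1 ->
  1 - invq J s * bump s <= (/ (c * c) + 1) / INR J.
Proof.
  intros HJ Hc Hs. assert (HN := INR_cube_pos J HJ).
  assert (HJ' : 0 < INR J) by now apply lt_0_INR.
  assert (Hg := geo_bounds (1 - s) J ltac:(lra)).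
  assert (HI : 0 < / INR (J * J * J)) by now apply Rinv_0_lt_compat.
  set (r := geo (1 - s) J) in *.
  assert (Hy : 0 <= / INR (J * J * J) * r) by nra.
  rewrite bump_pos by lra.
  assert (H1 : exp (r - r * r / INR (J * J * J)) <= invq J s).
  { eapply Rle_trans; [|apply exp_le_compound, Hy]. fold r.
    apply Req_le; f_equal; field; lra. }
  assert (H2 : exp (r - r * r / INR (J * J * J)) * exp (- / s) <= invq J s * exp (- / s)).
  { apply Rmult_le_compat_r; [apply Rlt_le, exp_pos|assumption]. }
  rewrite <- exp_plus in H2.
  assert (H3 := exp_ineq1_le (r - r * r / INR (J * J * J) + - / s)).
  assert (H4 : r * r / INR (J * J * J) <= / INR J).
  { apply Rle_div_l; [assumption|]. rewrite !mult_INR.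
    replace (/ INR J * (INR J * INR J * INR J)) with (INR J * INR J) by (field; lra).
    nra. }
  assert (H5 : / s - r <= / (c * c) / INR J).
  { assert (E := geo_sum (1 - s) J). fold r in E.
    assert (P := pow_one_minus_le s J ltac:(lra)).
    assert (0 <= (1 - s) ^ J) by (apply pow_le; lra).
    assert (Hp : (1 - s) ^ J * (INR J * s) <= 1) by nra.
    replace (/ s - r) with ((1 - s) ^ J / s).
    2:{ replace ((1 - s) ^ J) with (1 - s * r) by lra. field; lra. }
    replace (/ (c * c) / INR J) with (/ (c * c * INR J)) by (field; lra).
    apply Rle_trans with (/ (s * s * INR J)).
    - apply Rmult_le_reg_r with (s * s * INR J); [apply Rmult_lt_0_compat; nra|].
      rewrite Rinv_l by (apply Rgt_not_eq, Rmult_lt_0_compat; nra).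
      replace ((1 - s) ^ J / s * (s * s * INR J)) with ((1 - s) ^ J * (INR J * s))
        by (field; lra).
      assumption.
    - apply Rinv_le_contravar; [apply Rmult_lt_0_compat; nra|].
      apply Rmult_le_compat_r; nra. }
  replace ((/ (c * c) + 1) / INR J) with (/ (c * c) / INR J + / INR J)
    by (unfold Rdiv; ring).
  lra.
Qed.

Lemma int_le_const f a b c : cont f -> a <= b -> (forall x, a < x < b -> f x <= c) ->
  RInt f a b <= (b - a) * c.
Proof.
  intros Hf Hab H; rewrite <- int_const.
  apply RInt_le; [assumption|apply cont_ex_RInt, Hf|apply cont_ex_RInt, cont_const|assumption].
Qed.

Lemma int_chasles f a b c : cont f -> RInt f a c = RInt f a b + RInt f b c.
Proof. intros Hf; symmetry; apply (RInt_Chasles f a b c); now apply cont_ex_RInt. Qed.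

Lemma hav_ge d t : 0 <= d -> d <= t <= 2 * PI - d -> hav d <= hav t.
Proof.
  intros Hd Ht; unfold hav. assert (cos t <= cos d); [|lra].
  destruct (Rle_lt_dec t PI) as [H|H]; [apply cos_decr_1; lra|].
  replace (cos t) with (cos (2 * PI - t))
    by (rewrite cos_minus, cos_2PI, sin_2PI; ring).
  apply cos_decr_1; lra.
Qed.

(** Within [d] of the endpoints the integrand is at most 1, elsewhere at most eps/2. Stating it for
    any [f] with these values lets it be applied directly to a [Cnorm2] integrand. *)
Lemma invq_weight_L2 eps : 0 < eps -> exists J, (0 < J)%nat /\
  forall f, cont f -> (forall t, f t = (1 - invq J (hav t) * bump (hav t)) ^ 2) ->
  RInt f 0 (2 * PI) <= 2 * PI * eps.
Proof.
  intros He. assert (HP : 2 < PI) by (generalize PI2_1; lra).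
  (* The two end intervals contribute at most 2d <= eps, the middle one at most PI * eps. *)
  set (d := Rmin 1 (eps / 2)).
  assert (Hd : 0 < d <= 1 /\ d <= eps / 2).
  { unfold d; generalize (Rmin_l 1 (eps / 2)) (Rmin_r 1 (eps / 2)); intros.
    split; [split; [apply Rmin_glb_lt; lra|lra]|lra]. }
  assert (Hc : 0 < hav d).
  { unfold hav. assert (cos d < cos 0) by (apply cos_decreasing_1; lra).
    rewrite cos_0 in *; lra. }
  set (c := hav d) in *.
  assert (Hic : 0 < / (c * c)) by (apply Rinv_0_lt_compat; nra).
  set (A := / (c * c) + 1).
  destruct (nfloor_ex (A / (eps / 2))) as [n Hn].
  { apply Rdiv_le_0_compat; unfold A; lra. }
  exists (S n); split; [lia|]. intros f Hf Ef.
  assert (HA : A / INR (S n) <= eps / 2).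
  { rewrite S_INR. destruct Hn as [Hn0 Hn].
    apply Rle_div_l; [generalize (pos_INR n); lra|].
    apply Rlt_div_l in Hn; lra. }
  assert (Hb : forall t, 0 <= invq (S n) (hav t) * bump (hav t) <= 1).
  { intros t; apply invq_bump_bounds; [lia|apply hav_bounds]. }
  assert (Hf1 : forall t, f t <= 1).
  { intros t; rewrite Ef; specialize (Hb t); simpl; nra. }
  rewrite (int_chasles f 0 d (2 * PI)), (int_chasles f d (2 * PI - d) (2 * PI))
    by assumption.
  assert (I1 : RInt f 0 d <= (d - 0) * 1) by (apply int_le_const; auto; lra).
  assert (I3 : RInt f (2 * PI - d) (2 * PI) <= (2 * PI - (2 * PI - d)) * 1)
    by (apply int_le_const; auto; lra).
  assert (I2 : RInt f d (2 * PI - d) <= (2 * PI - d - d) * (eps / 2)).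
  { apply int_le_const; [assumption|lra|]. intros t Ht.
    assert (H := invq_bump_near1 (S n) c (hav t) ltac:(lia) Hc).
    assert (Hh := hav_ge d t ltac:(lra) ltac:(lra)). fold c in Hh.
    specialize (H (conj Hh (proj2 (hav_bounds t)))).
    rewrite Ef. specialize (Hb t). fold A in H. simpl; nra. }
  assert (0 <= d * eps) by nra. nra.
Qed.

(** * Functions with reachable Fourier vectors, and their multipliers *)

(** Asking for all integer translates makes the property stable under negative modes, hence under
    multiplication by cosines. *)
Definition Good (k : nat) (h : vec) (F : R -> C) : Prop :=
  Ccont F /\ forall i, Reach k h (zshift i (fourier F)).

Lemma good_ext k h F G : (forall t, F t = G t) -> Good k h F -> Good k h G.
Proof.
  intros H HF; replace G with F; [assumption|]. apply functional_extensionality, H.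
Qed.

Lemma good_add k h F G : Good k h F -> Good k h G ->
  Good k h (fun t => Cadd (F t) (G t)).
Proof.
  intros [F1 F2] [G1 G2]; split; [now apply Ccont_add|]. intros i.
  rewrite fourier_add by assumption.
  replace (zshift i _) with (vadd (zshift i (fourier F)) (zshift i (fourier G))) by veq.
  apply reach_add; auto.
Qed.

Lemma good_scal k h r F : Good k h F -> Good k h (fun t => Cmul (r, 0) (F t)).
Proof.
  intros [F1 F2]; split; [apply Ccont_mul; [apply Ccont_const|assumption]|]. intros i.
  rewrite fourier_scal by assumption.
  replace (zshift i _) with (vscale (r, 0) (zshift i (fourier F))) by veq.
  apply reach_scale; auto.
Qed.

Lemma good_mode k h n F : Good k h F -> Good k h (fun t => Cmul (mode n t) (F t)).
Proof.
  intros [F1 F2]; split; [apply Ccont_mul; [apply Ccont_mode|assumption]|]. intros i.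
  rewrite fourier_mode.
  replace (zshift i _) with (zshift (i + n) (fourier F)); [apply F2|].
  apply vec_ext; intros; cbn [zshift fst snd]; [f_equal; lia|reflexivity].
Qed.

Definition multiplier (k : nat) (h : vec) (m : R -> R) : Prop :=
  forall F, Good k h F -> Good k h (fun t => Cmul (m t, 0) (F t)).

(** On the circle, [hav] is the Laurent polynomial 1/2 - (z + 1/z)/4. *)
Lemma multiplier_hav k h : multiplier k h hav.
Proof.
  intros F HF. apply good_ext with (F := fun t =>
    Cadd (Cmul (/ 2, 0) (F t)) (Cmul (- / 4, 0)
      (Cadd (Cmul (mode 1 t) (F t)) (Cmul (mode (-1) t) (F t))))).
  - intros t; unfold mode, hav.
    replace (-1 * t) with (- (1 * t)) by ring. rewrite cos_neg, sin_neg, Rmult_1_l.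
    ceq; field.
  - apply good_add; [|apply good_scal, good_add]; auto using good_scal, good_mode.
Qed.

Lemma multiplier_const k h r : multiplier k h (fun _ => r).
Proof. intros F; apply good_scal. Qed.

Lemma multiplier_add k h m n : multiplier k h m -> multiplier k h n ->
  multiplier k h (fun t => m t + n t).
Proof.
  intros Hm Hn F HF.
  apply good_ext with (F := fun t => Cadd (Cmul (m t, 0) (F t)) (Cmul (n t, 0) (F t))).
  - intros t; ceq.
  - apply good_add; auto.
Qed.

Lemma multiplier_mul k h m n : multiplier k h m -> multiplier k h n ->
  multiplier k h (fun t => m t * n t).
Proof.
  intros Hm Hn F HF.
  apply good_ext with (F := fun t => Cmul (m t, 0) (Cmul (n t, 0) (F t))).
  - intros t; ceq.
  - apply (Hm (fun t => Cmul (n t, 0) (F t))); auto.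
Qed.

Lemma multiplier_pow k h m n : multiplier k h m -> multiplier k h (fun t => m t ^ n).
Proof.
  intros Hm; induction n as [|n IH]; simpl; [apply multiplier_const|].
  now apply multiplier_mul.
Qed.

Lemma multiplier_invq k h J : multiplier k h (fun t => invq J (hav t)).
Proof.
  apply multiplier_pow, multiplier_add, multiplier_mul; try apply multiplier_const.
  induction J as [|J IH]; simpl; [apply multiplier_const|].
  apply multiplier_add; [exact IH|]. apply multiplier_pow, multiplier_add.
  - apply multiplier_const.
  - intros F HF. apply good_ext with (F := fun t => Cmul (-1, 0) (Cmul (hav t, 0) (F t))).
    + intros t; ceq.
    + apply good_scal, multiplier_hav, HF.
Qed.

(** The multiples of the weight by [invq J (hav t)] tend to 1 in mean square, and Bessel's
    inequality carries this to the Fourier vectors. *)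
Lemma good_one k h : Good k h weight -> Good k h (fun _ => (1, 0)).
Proof.
  intros Hw; split; [apply Ccont_const|]. intros i. apply reach_closed; intros eps He.
  destruct (invq_weight_L2 eps He) as (J & _ & HJ).
  destruct (multiplier_invq k h J weight Hw) as [G1 G2].
  set (G := fun t => Cmul (invq J (hav t), 0) (weight t)) in *.
  exists (zshift i (fourier G)); split; [apply G2|].
  assert (H1 : Ccont (fun _ => (1, 0))) by apply Ccont_const.
  assert (HG : Ccont (fun t => Cmul (-1, 0) (G t)))
    by (apply Ccont_mul; [apply Ccont_const|assumption]).
  assert (HD := Ccont_add _ _ H1 HG).
  replace (vsub _ _) with
    (zshift i (fourier (fun t => Cadd (1, 0) (Cmul (-1, 0) (G t))))).
  - apply norm2_le_zshift, norm2_le_fourier; [assumption|].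
    apply HJ; [now apply Cnorm2_cont|].
    intros t; unfold Cnorm2, G, weight; simpl; ring.
  - rewrite fourier_add, fourier_scal by assumption. veq.
Qed.

Lemma fourier_one : fourier (fun _ => (1, 0)) = eZ 0.
Proof.
  replace (fun _ : R => (1, 0)) with (mode 0).
  - apply vec_ext; intros; [|reflexivity]. simpl; rewrite coef_mode.
    destruct (Z.eq_dec 0 z), (Z.eq_dec z 0); try reflexivity; lia.
  - apply functional_extensionality; intros t; unfold mode.
    now rewrite Rmult_0_l, cos_0, sin_0.
Qed.

Theorem mainTheorem19 : forall k : nat, (1 <= k)%nat -> cyclic_T k.
Proof.
  intros k Hk.
  assert (HU : forall j n, snd (fourier weight) j n = C0) by reflexivity.
  assert (HB : norm2_le k (fourier weight) 1).
  { apply norm2_le_fourier_sup; [apply Ccont_weight|]. intros t.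
    assert (Hh := hav_bounds t). assert (Hb := bump_le (hav t) ltac:(lra)).
    unfold Cnorm2; simpl; nra. }
  destruct (coupled_vector k (fourier weight) 1 Hk HB HU (annihilable_weight k))
    as (h & Hh & HN & HF).
  exists h; split; [assumption|]. intros x [Hx [B HxB]] eps He.
  assert (HR : Reach k h x).
  { apply reach_of_coordinates with B; [exact HxB| |].
    - intros z; apply reach_scale.
      (* The translates of the Fourier vector of the constant 1 are exactly the basis vectors
         [eZ z]. *)
      destruct (good_one k h) as [_ H1].
      + split; [apply Ccont_weight|].
        now apply reach_zshift; [|apply annihilable_weight|].
      + specialize (H1 z); rewrite fourier_one in H1.
        replace (eZ z) with (zshift z (eZ 0)); [assumption|].
        apply vec_ext; intros; [|reflexivity]. simpl.
        destruct (Z.eq_dec (z0 - z) 0), (Z.eq_dec z0 z); try reflexivity; lia.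
    - intros j n. destruct (Nat.lt_ge_cases j k) as [Hj|Hj].
      + apply reach_scale; auto.
      + rewrite Hx by assumption.
        replace (vscale C0 (eN j n)) with vzero by veq. apply reach_zero. }
  (* [Reach] bounds the squared distance; halving [eps] yields the strict inequality of
     [dist_lt]. *)
  destruct (HR (eps / 2 * (eps / 2)) ltac:(nra)) as (N & c & Hc).
  exists N, c, (eps / 2); split; [lra|split; [lra|exact Hc]].
Qed.
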